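(* Consider planar discontinuous piecewise differential systems \[ (\dot x,\dot y)=\begin{cases} F^{+}(x,y), & x\ge 0,\\ F^{-}(x,y), & x\le 0,\end{cases} \] separated by the straight line $\Sigma=\{x=0\}$, each of whose two subsystems belongs to one of the classes $(\mathtt{S}_1),\dots,(\mathtt{S}_4)$ defined in the context. Then: \begin{itemize} \item[(i)] there exist such piecewise systems formed by a subsystem of class $(\mathtt{S}_1)$ and a subsystem of class $(\mathtt{S}_2)$ with three crossing limit cycles; \item[(ii)] there exist such piecewise systems formed by two subsystems of class $(\mathtt{S}_3)$ with three crossing limit cycles; \item[(iii)] there exist such piecewise systems formed by a subsystem of class $(\mathtt{S}_3)$ and a subsystem of class $(\mathtt{S}_4)$ with three crossing limit cycles; \item[(iv)] there exist such piecewise systems formed by two subsystems of class $(\mathtt{S}_4)$ with three crossing limit cycles. \end{itemize}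
   Context: The four cubic isochronous centers are $S_1:\ \dot x=-y+x^3-xy^2,\ \dot y=x+x^2y-y^3$; $S_2:\ \dot x=-y+x^3-3xy^2,\ \dot y=x+3x^2y-y^3$; $S_3:\ \dot x=-y+3x^2y,\ \dot y=x-2x^3+9xy^2$; $S_4:\ \dot x=-y-3x^2y,\ \dot y=x+2x^3-9xy^2$. For $i=1,2,3,4$, a vector field $F$ on $\mathbb{R}^2$ belongs to class $(\mathtt{S}_i)$ if there is an invertible affine map $\varphi(x,y)=(ax+by+c,\ \alpha x+\beta y+\gamma)$ (with $b\alpha-a\beta\neq0$) such that $F(p)=(D\varphi)^{-1}S_i(\varphi(p))$ for all $p$, i.e. $F$ is $S_i$ written in the coordinates given by the affine change of variables $\varphi$. Writing $F^{\pm}=(X^{\pm},Y^{\pm})$, a point $p\in\Sigma$ is a crossing point if $X^{+}(p)X^{-}(p)>0$. A periodic solution of the piecewise system is of crossing type if it intersects $\Sigma$ at exactly two points, both crossing points; a crossing limit cycle is a crossing-type periodic solution that is isolated among such periodic solutions. *)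

(* Defs.v *)
From Stdlib Require Import Reals.
From Coquelicot Require Import Coquelicot.
Open Scope R_scope.

Definition vfield := (R * R)%type -> (R * R)%type.

Definition S1 : vfield := fun p => let (x, y) := p in
  (- y + x ^ 3 - x * y ^ 2, x + x ^ 2 * y - y ^ 3).
Definition S2 : vfield := fun p => let (x, y) := p in
  (- y + x ^ 3 - 3 * x * y ^ 2, x + 3 * x ^ 2 * y - y ^ 3).
Definition S3 : vfield := fun p => let (x, y) := p in
  (- y + 3 * x ^ 2 * y, x - 2 * x ^ 3 + 9 * x * y ^ 2).
Definition S4 : vfield := fun p => let (x, y) := p in
  (- y - 3 * x ^ 2 * y, x + 2 * x ^ 3 - 9 * x * y ^ 2).

(* F belongs to class (S): F(p) = (D phi)^{-1} S(phi(p)) for an invertible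
   affine map phi(x,y) = (a x + b y + c, al x + be y + ga), b al - a be <> 0.
   (D phi)^{-1} = 1/(a be - b al) * [[be, -b], [-al, a]]. *)
Definition in_class (S F : vfield) : Prop :=
  exists a b c al be ga : R,
    b * al - a * be <> 0 /\
    forall x y : R,
      let u := fst (S (a * x + b * y + c, al * x + be * y + ga)) in
      let v := snd (S (a * x + b * y + c, al * x + be * y + ga)) in
      F (x, y) = ((be * u - b * v) / (a * be - b * al),
                  (- al * u + a * v) / (a * be - b * al)).

Definition solution_on (F : vfield) (g : R -> R * R) (T : R) : Prop :=
  forall t, 0 <= t <= T ->
    is_derive (fun s => fst (g s)) t (fst (F (g t))) /\
    is_derive (fun s => snd (g s)) t (snd (F (g t))).

Definition crossing_point (Fp Fm : vfield) (y : R) : Prop :=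
  fst (Fp (0, y)) * fst (Fm (0, y)) > 0.

Definition crossing_periodic (Fp Fm : vfield) (Gamma : R * R -> Prop) : Prop :=
  exists (y1 y2 T1 T2 : R) (g1 g2 : R -> R * R),
    y1 <> y2 /\ crossing_point Fp Fm y1 /\ crossing_point Fp Fm y2 /\
    0 < T1 /\ 0 < T2 /\
    solution_on Fp g1 T1 /\ g1 0 = (0, y1) /\ g1 T1 = (0, y2) /\
    (forall t, 0 < t < T1 -> fst (g1 t) > 0) /\
    solution_on Fm g2 T2 /\ g2 0 = (0, y2) /\ g2 T2 = (0, y1) /\
    (forall t, 0 < t < T2 -> fst (g2 t) < 0) /\
    (forall z, Gamma z <->
       (exists t, 0 <= t <= T1 /\ z = g1 t) \/
       (exists t, 0 <= t <= T2 /\ z = g2 t)).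

Definition same_set (A B : R * R -> Prop) : Prop := forall z, A z <-> B z.

Definition open_set (U : R * R -> Prop) : Prop :=
  forall z, U z -> exists eps, eps > 0 /\
    forall w, Rabs (fst w - fst z) < eps -> Rabs (snd w - snd z) < eps -> U w.

Definition crossing_limit_cycle (Fp Fm : vfield) (Gamma : R * R -> Prop) : Prop :=
  crossing_periodic Fp Fm Gamma /\
  exists U, open_set U /\ (forall z, Gamma z -> U z) /\
    forall Gamma', crossing_periodic Fp Fm Gamma' ->
      (forall z, Gamma' z -> U z) -> same_set Gamma' Gamma.

Definition has_three_crossing_limit_cycles (Fp Fm : vfield) : Prop :=
  exists G1 G2 G3 : R * R -> Prop,
    crossing_limit_cycle Fp Fm G1 /\ crossing_limit_cycle Fp Fm G2 /\
    crossing_limit_cycle Fp Fm G3 /\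
    ~ same_set G1 G2 /\ ~ same_set G1 G3 /\ ~ same_set G2 G3.

Definition exists_example (Si Sj : vfield) : Prop :=
  exists Fp Fm : vfield,
    ((in_class Si Fp /\ in_class Sj Fm) \/ (in_class Sj Fp /\ in_class Si Fm)) /\
    has_three_crossing_limit_cycles Fp Fm.

(* Main.v *)
Require Import Defs.
From Stdlib Require Import Reals Ranalysis5 Lra List Classical FunctionalExtensionality.
From Coquelicot Require Import Coquelicot.
Open Scope R_scope.

(** Each of the four centres has a rational first integral N / D whose numerator and denominator have
    the same cofactor, so an arc of either subsystem joining two points of the switching line forces
    N D' = N' D there.  In each example one side is chosen so that its relation is a rational curve:
    the pairs are the t, t' with t t' = 5/4 for S1, and they are parametrised by a point of the unit
    circle for S4 above the line y = 2 / (3 sqrt 3) and for S3 above the axis y = 0, around its second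
    centre.  The relation of the other side then becomes one rational equation in the parameter: its
    signs at four sample values give three solutions by the intermediate value theorem, and a nonzero polynomial has
    finitely many roots, so the periodic orbits are isolated.  The arcs themselves are level curves of
    the first integral, written as graphs over the line or over its rays and run with the right speed;
    they stay on one side because the first integral is unimodal along the line between their ends. *)

(** * Polynomials, differential inequalities and uniqueness *)

(** The ends of a crossing orbit satisfy two polynomial equations in two unknowns, and isolation
    must exclude every competing orbit, not only those of a chosen family. Making one of the two
    curves rational replaces elimination by root counting in a single variable. The first integrals
    and the explicit arcs serve opposite directions. Conservation holds for any solution, so it
    gives necessary conditions on a competitor; the level curves give existence without a general
    theorem for differential equations. Uniqueness for locally Lipschitz fields then identifies a
    competitor having the same ends, in the same order, with the constructed cycle. Competitors are
    controlled only when their ends lie in an interval of the switching line on which the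
    parametrisation reaches every pair. This suffices: the neighbourhood that witnesses isolation
    may contain everything off the line and still be selective on it. The decimal coefficients of
    the second field in each example have no structure. They make the equation in the parameter
    change sign three times, and keep the line where the sign conditions of the arc lemmas hold. *)

Fixpoint peval (l : list R) (x : R) : R :=
  match l with nil => 0 | a :: l' => a + x * peval l' x end.

Definition polynomial (f : R -> R) : Prop :=
  exists l, forall x, f x = peval l x.

Lemma polynomial_ext (f g : R -> R) :
  (forall x, f x = g x) -> polynomial f -> polynomial g.
Proof. intros H [l Hl]; exists l; intros x; now rewrite <- H. Qed.

Lemma polynomial_const (c : R) : polynomial (fun _ => c).
Proof. exists (c :: nil); intros x; simpl; ring. Qed.

Lemma polynomial_id : polynomial (fun x => x).
Proof. exists (0 :: 1 :: nil); intros x; simpl; ring. Qed.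

Lemma polynomial_plus (f g : R -> R) :
  polynomial f -> polynomial g -> polynomial (fun x => f x + g x).
Proof.
intros [l Hl] [k Hk].
assert (H : exists m, forall x, peval l x + peval k x = peval m x).
{ clear f g Hl Hk; revert k; induction l as [|a l IH]; intros k.
  - exists k; intros x; simpl; ring.
  - destruct k as [|b k].
    + exists (a :: l); intros x; simpl; ring.
    + destruct (IH k) as [m Hm]; exists (a + b :: m); intros x; simpl.
      rewrite <- Hm; ring. }
destruct H as [m Hm]; exists m; intros x; now rewrite Hl, Hk.
Qed.

Lemma polynomial_mult (f g : R -> R) :
  polynomial f -> polynomial g -> polynomial (fun x => f x * g x).
Proof.
intros [l Hl] [k Hk].
assert (Hs : forall c (m : list R), polynomial (fun x => c * peval m x)).
{ intros c m; exists (map (Rmult c) m); intros x; induction m as [|b m IH]; simpl; [ring|].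
  rewrite <- IH; ring. }
assert (H : polynomial (fun x => peval l x * peval k x)).
{ clear f g Hl Hk; induction l as [|a l [m Hm]].
  - exists nil; intros x; simpl; ring.
  - apply (polynomial_ext (fun x => a * peval k x + peval (0 :: m) x)).
    + intros x; simpl; rewrite <- Hm; ring.
    + apply polynomial_plus; [apply Hs|]; now exists (0 :: m). }
apply (polynomial_ext _ _ (fun x => f_equal2 Rmult (eq_sym (Hl x)) (eq_sym (Hk x))) H).
Qed.

Lemma polynomial_pow (f : R -> R) (n : nat) :
  polynomial f -> polynomial (fun x => f x ^ n).
Proof.
intros Hf; induction n as [|n IH]; simpl.
- apply polynomial_const.
- now apply polynomial_mult.
Qed.

Lemma polynomial_opp (f : R -> R) : polynomial f -> polynomial (fun x => - f x).
Proof.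
intros Hf; apply (polynomial_ext (fun x => -1 * f x)); [intros; ring|].
apply polynomial_mult; [apply polynomial_const|exact Hf].
Qed.

Lemma polynomial_minus (f g : R -> R) :
  polynomial f -> polynomial g -> polynomial (fun x => f x - g x).
Proof. intros Hf Hg; apply polynomial_plus; [exact Hf|now apply polynomial_opp]. Qed.

Ltac polynomial_tac :=
  repeat first [apply polynomial_const | apply polynomial_id | apply polynomial_mult
    | apply polynomial_minus | apply polynomial_plus | apply polynomial_pow].

Lemma polynomial_continuity (f : R -> R) : polynomial f -> continuity f.
Proof.
intros [l Hl].
assert (H : continuity (peval l)).
{ clear; induction l as [|a l IH].
  - apply continuity_const; intros x y; reflexivity.
  - change (continuity (fct_cte a + (id * peval l))%F).
    apply continuity_plus; [apply continuity_const; intros x y; reflexivity|].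
    apply continuity_mult; [apply derivable_continuous, derivable_id|exact IH]. }
intros x; apply (continuity_pt_ext (peval l)); [intros; now rewrite Hl|apply H].
Qed.

(** Synthetic division by [x - r]. The length of the quotient is recorded because root counting goes
    by induction on the number of coefficients. *)
Lemma peval_factor (a : R) (l : list R) (r : R) :
  exists q, length q = length l /\
    forall x, peval (a :: l) x = peval (a :: l) r + (x - r) * peval q x.
Proof.
revert a; induction l as [|b l IH]; intros a.
- exists nil; split; [reflexivity|]; intros x; simpl; ring.
- destruct (IH b) as [q [Hq Hx]]; exists (peval (b :: l) r :: q).
  split; [simpl; now rewrite Hq|].
  intros x; change (a + x * peval (b :: l) x = a + r * peval (b :: l) r
    + (x - r) * (peval (b :: l) r + x * peval q x)).
  rewrite Hx; ring.
Qed.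

Lemma polynomial_roots_finite (f : R -> R) (x0 : R) :
  polynomial f -> f x0 <> 0 -> exists L, forall x, f x = 0 -> In x L.
Proof.
intros [l Hl]; rewrite Hl; intros H0.
assert (H : exists L, forall x, peval l x = 0 -> In x L).
{ clear f Hl; remember (length l) as n eqn:Hn; revert l Hn H0.
  induction n as [|n IH]; intros [|a l] Hn H0; try discriminate; try (now destruct H0).
  destruct (classic (exists r, peval (a :: l) r = 0)) as [[r Hr]|Hno].
  - destruct (peval_factor a l r) as [q [Hq Hx]]; rewrite Hr in Hx.
    destruct (IH q) as [L HL].
    + injection Hn as Hn; congruence.
    + intros E; apply H0; rewrite Hx, E; ring.
    + exists (r :: L); intros x Ex; rewrite Hx in Ex.
      destruct (Req_dec x r) as [->|Hne]; [now left|right; apply HL].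
      apply (Rmult_eq_reg_l (x - r)); [lra|]; intros E; apply Hne; lra.
  - exists nil; intros x Ex; apply Hno; now exists x. }
destruct H as [L HL]; exists L; intros x; rewrite Hl; apply HL.
Qed.

(** A fixed denominator [B] makes sums and products easy: exponents just add. Nothing is said at the
    zeros of [B], where division has no meaning; elsewhere the zeros of [f] are those of the
    polynomial [g]. *)
Definition rational_over (B f : R -> R) : Prop :=
  exists (n : nat) (g : R -> R), polynomial g /\
    forall x, B x <> 0 -> f x * B x ^ n = g x.

Lemma rational_polynomial (B f : R -> R) : polynomial f -> rational_over B f.
Proof. intros Hf; exists 0%nat, f; split; [exact Hf|intros; simpl; ring]. Qed.

Lemma rational_quotient (B f : R -> R) :
  polynomial f -> rational_over B (fun x => f x / B x).
Proof. intros Hf; exists 1%nat, f; split; [exact Hf|intros; simpl; field; assumption]. Qed.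

Lemma rational_plus (B f g : R -> R) : polynomial B ->
  rational_over B f -> rational_over B g -> rational_over B (fun x => f x + g x).
Proof.
intros HB [n [f' [Pf Hf]]] [k [g' [Pg Hg]]].
exists (n + k)%nat, (fun x => f' x * B x ^ k + g' x * B x ^ n); split.
- apply polynomial_plus; apply polynomial_mult; auto using polynomial_pow.
- intros x Hx; rewrite <- Hf, <- Hg, pow_add by assumption; ring.
Qed.

Lemma rational_mult (B f g : R -> R) : polynomial B ->
  rational_over B f -> rational_over B g -> rational_over B (fun x => f x * g x).
Proof.
intros HB [n [f' [Pf Hf]]] [k [g' [Pg Hg]]].
exists (n + k)%nat, (fun x => f' x * g' x); split.
- now apply polynomial_mult.
- intros x Hx; rewrite <- Hf, <- Hg, pow_add by assumption; ring.
Qed.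

Lemma rational_pow (B f : R -> R) (n : nat) : polynomial B ->
  rational_over B f -> rational_over B (fun x => f x ^ n).
Proof.
intros HB Hf; induction n as [|n IH]; simpl.
- apply rational_polynomial, polynomial_const.
- now apply rational_mult.
Qed.

Lemma rational_minus (B f g : R -> R) : polynomial B ->
  rational_over B f -> rational_over B g -> rational_over B (fun x => f x - g x).
Proof.
intros HB Hf [k [g' [Pg Hg]]]; apply rational_plus; [exact HB|exact Hf|].
exists k, (fun x => - g' x); split; [now apply polynomial_opp|].
intros x Hx; rewrite <- Hg by assumption; ring.
Qed.

Lemma rational_roots_finite (B f : R -> R) (x0 : R) :
  rational_over B f -> B x0 <> 0 -> f x0 <> 0 ->
  exists L, forall x, B x <> 0 -> f x = 0 -> In x L.
Proof.
intros [n [g [Pg Hg]]] HB Hf.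
destruct (polynomial_roots_finite g x0 Pg) as [L HL].
- rewrite <- Hg by assumption; apply Rmult_integral_contrapositive_currified; auto using pow_nonzero.
- exists L; intros x HBx Hx; apply HL; rewrite <- Hg, Hx by assumption; ring.
Qed.

Lemma rational_zero_between (B f : R -> R) (a b : R) :
  rational_over B f -> a < b -> (forall x, a <= x <= b -> 0 < B x) ->
  f a * f b < 0 -> exists x, a < x < b /\ f x = 0.
Proof.
intros [n [g [Pg Hg]]] Hab HB Hs.
assert (Ha := HB a ltac:(lra)); assert (Hb := HB b ltac:(lra)).
assert (Pa := pow_lt _ n Ha); assert (Pb := pow_lt _ n Hb).
destruct (IVT_cor g a b (polynomial_continuity g Pg)) as [z [Hz Ez]]; [lra| |].
- rewrite <- !Hg by lra.
  replace (f a * B a ^ n * (f b * B b ^ n)) with ((f a * f b) * (B a ^ n * B b ^ n)) by ring.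
  assert (H := Rmult_lt_0_compat _ _ Pa Pb).
  apply Rlt_le; replace 0 with (0 * (B a ^ n * B b ^ n)) by ring.
  now apply Rmult_lt_compat_r.
- assert (Hz0 := HB z Hz); assert (Pz := pow_lt _ n Hz0).
  assert (E : f z = 0).
  { apply (Rmult_eq_reg_r (B z ^ n)); [|lra]; rewrite Hg, Ez by lra; ring. }
  exists z; split; [|exact E].
  assert (z <> a) by (intros ->; rewrite E in Hs; lra).
  assert (z <> b) by (intros ->; rewrite E in Hs; lra).
  lra.
Qed.

(** * Gronwall's argument and functions with a common cofactor *)

Lemma bounded_on_segment (f : R -> R) (T : R) : 0 <= T ->
  (forall t, 0 <= t <= T -> continuity_pt f t) ->
  exists M, forall t, 0 <= t <= T -> Rabs (f t) <= M.
Proof.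
intros HT Hc.
destruct (continuity_ab_maj (fun t => Rabs (f t)) 0 T HT) as [m [Hm _]].
- intros t Ht; apply (continuity_pt_comp f Rabs); [now apply Hc|apply Rcontinuity_abs].
- exists (Rabs (f m)); exact Hm.
Qed.

Lemma is_derive_continuity_pt (f : R -> R) (x l : R) :
  is_derive f x l -> continuity_pt f x.
Proof.
intros H; apply derivable_continuous_pt; exists l; now apply is_derive_Reals.
Qed.

(** The function [u s * exp (- C * s)] starts at 0 and has nonpositive derivative, so it is both
    nonpositive and nonnegative. *)
Lemma gronwall_zero (u du : R -> R) (C T : R) :
  (forall t, 0 <= t <= T -> is_derive u t (du t)) ->
  (forall t, 0 <= t <= T -> 0 <= u t) ->
  (forall t, 0 <= t <= T -> du t <= C * u t) ->
  u 0 = 0 -> forall t, 0 <= t <= T -> u t = 0.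
Proof.
intros Hd Hp Hle H0 t Ht.
destruct (Req_dec t 0) as [->|Hne]; [exact H0|].
destruct (MVT_cor2 (fun s => u s * exp (- C * s))
   (fun s => (du s - C * u s) * exp (- C * s)) 0 t) as [c [Hc Hc']]; [lra| |].
- intros s Hs; apply is_derive_Reals.
  apply (is_derive_ext (fun s => u s * exp (- C * s))); [reflexivity|].
  evar_last.
  + apply (is_derive_mult u (fun s => exp (- C * s)) s (du s) (- C * exp (- C * s))).
    * apply Hd; lra.
    * auto_derive; [trivial|ring].
    * intros; apply Rmult_comm.
  + unfold plus, mult; simpl; unfold plus, mult; simpl; ring.
- rewrite H0 in Hc.
  assert (E1 := exp_pos (- C * t)); assert (E2 := exp_pos (- C * c)).
  assert (L := Hle c ltac:(lra)); assert (P := Hp t Ht).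
  assert ((du c - C * u c) * exp (- C * c) * (t - 0) <= 0).
  { assert (0 <= (C * u c - du c) * exp (- C * c) * t); [|lra].
    repeat apply Rmult_le_pos; lra. }
  assert (u t * exp (- C * t) <= 0) by lra.
  assert (0 <= u t * exp (- C * t)) by (apply Rmult_le_pos; lra).
  apply (Rmult_eq_reg_r (exp (- C * t))); lra.
Qed.

(* Stated without division, so that no assumption on the signs of [u] and [v] is needed. *)
Lemma cofactor_proportional (u v k : R -> R) (T : R) : 0 <= T ->
  (forall t, 0 <= t <= T -> is_derive u t (k t * u t)) ->
  (forall t, 0 <= t <= T -> is_derive v t (k t * v t)) ->
  (forall t, 0 <= t <= T -> continuity_pt k t) ->
  u 0 * v T = u T * v 0.
Proof.
intros HT Hu Hv Hk.
destruct (bounded_on_segment k T HT Hk) as [M HM].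
(* The determinant [u 0 * v t - u t * v 0] solves the same linear equation as [u] and [v] and
   vanishes at 0. Squaring makes it nonnegative, as [gronwall_zero] requires, and doubles the
   cofactor. *)
assert (H : (u 0 * v T - u T * v 0) ^ 2 = 0).
{ apply (gronwall_zero (fun t => (u 0 * v t - u t * v 0) ^ 2)
    (fun t => 2 * k t * (u 0 * v t - u t * v 0) ^ 2) (2 * M) T); try lra.
  - intros t Ht; evar_last.
    + apply (is_derive_pow (fun t => u 0 * v t - u t * v 0) 2 t
        (k t * (u 0 * v t - u t * v 0))).
      evar_last.
      * apply (is_derive_minus (V := R_NormedModule) (fun t => u 0 * v t) (fun t => u t * v 0)
          t (u 0 * (k t * v t)) (k t * u t * v 0)).
        -- now apply is_derive_scal, Hv.
        -- apply (is_derive_ext (fun t => v 0 * u t)); [intros; apply Rmult_comm|].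
           evar_last; [now apply is_derive_scal, Hu|]; simpl; ring.
      * unfold minus, plus, opp; simpl; ring.
    + simpl; ring.
  - intros t Ht; apply pow2_ge_0.
  - intros t Ht; assert (P := pow2_ge_0 (u 0 * v t - u t * v 0)).
    assert (k t <= M) by (apply Rle_trans with (2 := HM t Ht), Rle_abs).
    apply Rmult_le_compat_r; lra. }
assert (u 0 * v T - u T * v 0 = 0); [|lra].
destruct (Req_dec (u 0 * v T - u T * v 0) 0) as [E|E]; [exact E|].
now apply (pow_nonzero _ 2) in E.
Qed.

(** * Functions Lipschitz on every square, and uniqueness of solutions *)

Definition locally_lipschitz (f : R * R -> R) : Prop :=
  forall M, exists L, 0 <= L /\
    forall p q : R * R, Rabs (fst p) <= M -> Rabs (snd p) <= M ->
      Rabs (fst q) <= M -> Rabs (snd q) <= M ->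
      Rabs (f p - f q) <= L * (Rabs (fst p - fst q) + Rabs (snd p - snd q)).

Lemma locally_lipschitz_const (c : R) : locally_lipschitz (fun _ => c).
Proof.
intros M; exists 0; split; [lra|]; intros p q _ _ _ _.
rewrite Rminus_diag, Rabs_R0; lra.
Qed.

Lemma locally_lipschitz_fst : locally_lipschitz fst.
Proof.
intros M; exists 1; split; [lra|]; intros p q _ _ _ _.
assert (H := Rabs_pos (snd p - snd q)); lra.
Qed.

Lemma locally_lipschitz_snd : locally_lipschitz snd.
Proof.
intros M; exists 1; split; [lra|]; intros p q _ _ _ _.
assert (H := Rabs_pos (fst p - fst q)); lra.
Qed.

Lemma locally_lipschitz_plus (f g : R * R -> R) :
  locally_lipschitz f -> locally_lipschitz g -> locally_lipschitz (fun p => f p + g p).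
Proof.
intros Hf Hg M; destruct (Hf M) as [L [HL Lf]], (Hg M) as [K [HK Kg]].
exists (L + K); split; [lra|]; intros p q H1 H2 H3 H4.
replace (f p + g p - (f q + g q)) with ((f p - f q) + (g p - g q)) by ring.
eapply Rle_trans; [apply Rabs_triang|].
specialize (Lf p q H1 H2 H3 H4); specialize (Kg p q H1 H2 H3 H4); lra.
Qed.

Lemma locally_lipschitz_bounded (f : R * R -> R) : locally_lipschitz f ->
  forall M, exists B, 0 <= B /\
    forall p, Rabs (fst p) <= M -> Rabs (snd p) <= M -> Rabs (f p) <= B.
Proof.
(* With [Rabs M] in place of [M] the square is never empty, so the origin can serve as the
   comparison point. *)
intros Hf M; destruct (Hf (Rabs M)) as [L [HL Lf]].
exists (Rabs (f (0, 0)) + L * (Rabs M + Rabs M)).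
assert (P1 := Rabs_pos M); assert (P2 := Rabs_pos (f (0, 0))).
split; [assert (0 <= L * (Rabs M + Rabs M)) by (apply Rmult_le_pos; lra); lra|].
intros p H1 H2; assert (HM := Rle_abs M).
assert (H := Lf p (0, 0)); simpl in H; rewrite Rabs_R0, !Rminus_0_r in H.
assert (H3 : Rabs (f p) <= Rabs (f (0, 0)) + Rabs (f p - f (0, 0))).
{ replace (f p) with (f (0, 0) + (f p - f (0, 0))) at 1 by ring; apply Rabs_triang. }
assert (L * (Rabs (fst p) + Rabs (snd p)) <= L * (Rabs M + Rabs M))
  by (apply Rmult_le_compat_l; lra).
specialize (H ltac:(lra) ltac:(lra) ltac:(lra) ltac:(lra)); lra.
Qed.

Lemma locally_lipschitz_comp (f u v : R * R -> R) :
  locally_lipschitz f -> locally_lipschitz u -> locally_lipschitz v ->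
  locally_lipschitz (fun p => f (u p, v p)).
Proof.
intros Hf Hu Hv M.
destruct (locally_lipschitz_bounded u Hu M) as [A [PA HA]].
destruct (locally_lipschitz_bounded v Hv M) as [B [PB HB]].
destruct (Hu M) as [K [PK HK]], (Hv M) as [K' [PK' HK']], (Hf (A + B)) as [L [PL HL]].
exists (L * (K + K')); split; [apply Rmult_le_pos; lra|].
intros p q H1 H2 H3 H4.
assert (A1 := HA p H1 H2); assert (A2 := HA q H3 H4).
assert (B1 := HB p H1 H2); assert (B2 := HB q H3 H4).
eapply Rle_trans; [apply HL; simpl; lra|]; simpl.
rewrite Rmult_assoc; apply Rmult_le_compat_l; [exact PL|].
specialize (HK p q H1 H2 H3 H4); specialize (HK' p q H1 H2 H3 H4); lra.
Qed.

Lemma locally_lipschitz_mult (f g : R * R -> R) :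
  locally_lipschitz f -> locally_lipschitz g -> locally_lipschitz (fun p => f p * g p).
Proof.
intros Hf Hg M; destruct (Hf M) as [L [HL Lf]], (Hg M) as [K [HK Kg]].
destruct (locally_lipschitz_bounded f Hf M) as [Bf [Pf HBf]].
destruct (locally_lipschitz_bounded g Hg M) as [Bg [Pg HBg]].
exists (Bf * K + L * Bg); split.
{ assert (0 <= Bf * K) by now apply Rmult_le_pos.
  assert (0 <= L * Bg) by now apply Rmult_le_pos. lra. }
intros p q H1 H2 H3 H4.
replace (f p * g p - f q * g q) with (f p * (g p - g q) + (f p - f q) * g q) by ring.
eapply Rle_trans; [apply Rabs_triang|]; rewrite !Rabs_mult.
set (d := Rabs (fst p - fst q) + Rabs (snd p - snd q)).
assert (Rabs (f p) * Rabs (g p - g q) <= Bf * (K * d))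
  by (apply Rmult_le_compat; auto using Rabs_pos).
assert (Rabs (f p - f q) * Rabs (g q) <= (L * d) * Bg)
  by (apply Rmult_le_compat; auto using Rabs_pos).
lra.
Qed.

Lemma locally_lipschitz_opp (f : R * R -> R) :
  locally_lipschitz f -> locally_lipschitz (fun p => - f p).
Proof.
intros Hf M; destruct (Hf M) as [L [HL Lf]]; exists L; split; [exact HL|].
intros p q H1 H2 H3 H4.
replace (- f p - - f q) with (- (f p - f q)) by ring; rewrite Rabs_Ropp; now apply Lf.
Qed.

Lemma locally_lipschitz_minus (f g : R * R -> R) :
  locally_lipschitz f -> locally_lipschitz g -> locally_lipschitz (fun p => f p - g p).
Proof.
intros Hf Hg; apply locally_lipschitz_plus; [exact Hf|now apply locally_lipschitz_opp].
Qed.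

Lemma locally_lipschitz_pow (f : R * R -> R) (n : nat) :
  locally_lipschitz f -> locally_lipschitz (fun p => f p ^ n).
Proof.
intros Hf; induction n as [|n IH]; simpl.
- apply locally_lipschitz_const.
- now apply locally_lipschitz_mult.
Qed.

Definition lipschitz_field (F : vfield) : Prop :=
  locally_lipschitz (fun p => fst (F p)) /\ locally_lipschitz (fun p => snd (F p)).

(** On a compact time interval both solutions stay in one square, where the field has Lipschitz
    constants [L1] and [L2]. The squared distance then grows at rate at most [4 * (L1 + L2)], and
    Gronwall applies. *)
Lemma solution_unique (F : vfield) (g h : R -> R * R) (T : R) :
  lipschitz_field F -> 0 <= T -> solution_on F g T -> solution_on F h T -> g 0 = h 0 ->
  forall t, 0 <= t <= T -> g t = h t.
Proof.
intros [HF1 HF2] HT Hg Hh E0.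
assert (Hbd : forall k, solution_on F k T -> exists M, forall t, 0 <= t <= T ->
   Rabs (fst (k t)) <= M /\ Rabs (snd (k t)) <= M).
{ intros k Hk.
  destruct (bounded_on_segment (fun t => fst (k t)) T HT) as [A HA].
  { intros t Ht; destruct (Hk t Ht) as [D _]; exact (is_derive_continuity_pt _ _ _ D). }
  destruct (bounded_on_segment (fun t => snd (k t)) T HT) as [B HB].
  { intros t Ht; destruct (Hk t Ht) as [_ D]; exact (is_derive_continuity_pt _ _ _ D). }
  exists (Rmax A B); intros t Ht; split.
  - eapply Rle_trans; [now apply HA|apply Rmax_l].
  - eapply Rle_trans; [now apply HB|apply Rmax_r]. }
destruct (Hbd g Hg) as [Mg HMg], (Hbd h Hh) as [Mh HMh].
destruct (HF1 (Rmax Mg Mh)) as [L1 [P1 HL1]], (HF2 (Rmax Mg Mh)) as [L2 [P2 HL2]].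
set (L := L1 + L2).
set (u := fun t => (fst (g t) - fst (h t)) ^ 2 + (snd (g t) - snd (h t)) ^ 2).
assert (Hu : forall t, 0 <= t <= T -> u t = 0).
{ apply (gronwall_zero u (fun t =>
    2 * (fst (g t) - fst (h t)) * (fst (F (g t)) - fst (F (h t)))
    + 2 * (snd (g t) - snd (h t)) * (snd (F (g t)) - snd (F (h t)))) (4 * L) T).
  - intros t Ht; unfold u.
    destruct (Hg t Ht) as [G1 G2], (Hh t Ht) as [H1 H2].
    evar_last.
    + apply @is_derive_plus.
      * apply (is_derive_pow (fun t => fst (g t) - fst (h t)) 2 t
          (fst (F (g t)) - fst (F (h t)))).
        now apply (is_derive_minus (V := R_NormedModule) (fun t => fst (g t)) (fun t => fst (h t))).
      * apply (is_derive_pow (fun t => snd (g t) - snd (h t)) 2 t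
          (snd (F (g t)) - snd (F (h t)))).
        now apply (is_derive_minus (V := R_NormedModule) (fun t => snd (g t)) (fun t => snd (h t))).
    + unfold plus; simpl; ring.
  - intros t Ht; unfold u; assert (H1 := pow2_ge_0 (fst (g t) - fst (h t))).
    assert (H2 := pow2_ge_0 (snd (g t) - snd (h t))); lra.
  - intros t Ht; unfold u.
    destruct (HMg t Ht) as [A1 A2], (HMh t Ht) as [B1 B2].
    assert (M1 := Rmax_l Mg Mh); assert (M2 := Rmax_r Mg Mh).
    specialize (HL1 (g t) (h t) ltac:(lra) ltac:(lra) ltac:(lra) ltac:(lra)).
    specialize (HL2 (g t) (h t) ltac:(lra) ltac:(lra) ltac:(lra) ltac:(lra)).
    set (a := fst (g t) - fst (h t)) in *; set (b := snd (g t) - snd (h t)) in *.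
    set (c := fst (F (g t)) - fst (F (h t))) in *; set (d := snd (F (g t)) - snd (F (h t))) in *.
    assert (Pa := Rabs_pos a); assert (Pb := Rabs_pos b).
    assert (Ea : Rabs a * Rabs a = a ^ 2) by (rewrite <- Rabs_mult, Rabs_pos_eq; [ring|apply Rle_0_sqr]).
    assert (Eb : Rabs b * Rabs b = b ^ 2) by (rewrite <- Rabs_mult, Rabs_pos_eq; [ring|apply Rle_0_sqr]).
    assert (I1 : a * c <= Rabs a * (L1 * (Rabs a + Rabs b))).
    { eapply Rle_trans; [apply Rle_abs|]; rewrite Rabs_mult; apply Rmult_le_compat_l; lra. }
    assert (I2 : b * d <= Rabs b * (L2 * (Rabs a + Rabs b))).
    { eapply Rle_trans; [apply Rle_abs|]; rewrite Rabs_mult; apply Rmult_le_compat_l; lra. }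
    assert (Q := pow2_ge_0 (Rabs a - Rabs b)).
    replace ((Rabs a - Rabs b) ^ 2) with (Rabs a * Rabs a + Rabs b * Rabs b - 2 * (Rabs a * Rabs b))
      in Q by ring.
    rewrite Ea, Eb in Q.
    assert (Qa := pow2_ge_0 a); assert (Qb := pow2_ge_0 b).
    replace (Rabs a * (L1 * (Rabs a + Rabs b))) with (L1 * (Rabs a * Rabs a + Rabs a * Rabs b))
      in I1 by ring.
    replace (Rabs b * (L2 * (Rabs a + Rabs b))) with (L2 * (Rabs b * Rabs b + Rabs a * Rabs b))
      in I2 by ring.
    rewrite Ea in I1; rewrite Eb in I2.
    assert (K1 : L1 * (a ^ 2 + Rabs a * Rabs b) <= L1 * (2 * (a ^ 2 + b ^ 2)))
      by (apply Rmult_le_compat_l; lra).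
    assert (K2 : L2 * (b ^ 2 + Rabs a * Rabs b) <= L2 * (2 * (a ^ 2 + b ^ 2)))
      by (apply Rmult_le_compat_l; lra).
    unfold L; lra.
  - unfold u; rewrite E0; ring. }
intros t Ht; assert (E := Hu t Ht); unfold u in E.
rewrite <- !Rsqr_pow2 in E.
destruct (Rplus_sqr_eq_0 _ _ E) as [E1 E2].
rewrite (surjective_pairing (g t)), (surjective_pairing (h t)); f_equal; lra.
Qed.

(** * Arcs and affine changes of variables *)

Definition arc (F : vfield) (side : R * R -> Prop) (p q : R * R) : Prop :=
  exists (T : R) (g : R -> R * R), 0 < T /\ solution_on F g T /\ g 0 = p /\ g T = q /\
    forall t, 0 < t < T -> side (g t).

(** Separation of variables: the equation [sg' = c (sg)] is solved by inverting the elapsed time,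
    the integral of [/ c] from [s1]. *)
Lemma time_change (c : R -> R) (lo s1 s2 hi : R) :
  lo < s1 -> s1 < s2 -> s2 < hi ->
  (forall s, lo < s < hi -> continuity_pt c s /\ 0 < c s) ->
  exists T sg, 0 < T /\ sg 0 = s1 /\ sg T = s2 /\
    (forall t, 0 <= t <= T -> lo < sg t < hi /\ is_derive sg t (c (sg t))) /\
    (forall t, 0 < t < T -> s1 < sg t < s2).
Proof.
intros H1 H2 H3 Hc.
(* [solution_on] asks for two-sided derivatives at both end times, so the inverse is taken on a
   segment reaching strictly beyond [s1] and [s2]. *)
set (l := (lo + s1) / 2); set (h := (s2 + hi) / 2).
assert (Hl : lo < l < s1) by (unfold l; lra); assert (Hh : s2 < h < hi) by (unfold h; lra).
set (tau := fun s => RInt (fun r => / c r) s1 s).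
assert (Hcont : forall s, lo < s < hi -> continuous (fun r => / c r) s).
{ intros s Hs; destruct (Hc s Hs) as [C P]; apply continuous_Rinv_comp; [|lra].
  now apply continuity_pt_filterlim. }
assert (Hd : forall s, lo < s < hi -> is_derive tau s (/ c s)).
{ intros s Hs; apply (is_derive_RInt (fun r => / c r) tau s1 s); [|now apply Hcont].
  apply (locally_interval _ s lo hi); simpl; try lra; intros y Hy1 Hy2.
  apply (RInt_correct (V := R_CompleteNormedModule)), (ex_RInt_continuous (V := R_CompleteNormedModule)).
  intros z Hz; apply Hcont; revert Hz; unfold Rmin, Rmax; destruct (Rle_dec s1 y); lra. }
assert (Hinc : forall x y, l <= x -> x < y -> y <= h -> tau x < tau y).
{ intros x y Hx Hxy Hy.
  destruct (MVT_cor2 tau (fun s => / c s) x y Hxy) as [z [Ez Hz]].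
  - intros s Hs; apply is_derive_Reals, Hd; lra.
  - assert (P : 0 < / c z) by (apply Rinv_0_lt_compat, Hc; lra).
    assert (0 < / c z * (y - x)) by (apply Rmult_lt_0_compat; lra); lra. }
assert (Hct : forall s, l <= s <= h -> continuity_pt tau s).
{ intros s Hs; apply (is_derive_continuity_pt tau s (/ c s)), Hd; lra. }
assert (Hlh : l < h) by lra.
assert (Hex : forall t, tau l <= t <= tau h -> {s | l <= s <= h /\ tau s = t}).
{ intros t Ht; now apply f_interv_is_interv. }
(* Outside the range of [tau] the value [l] is a mere default; the times from 0 to [T] lie strictly
   inside that range. *)
set (sg := fun t => match Rle_dec (tau l) t with
  | left A => match Rle_dec t (tau h) with
     | left B => proj1_sig (Hex t (conj A B)) | right _ => l end
  | right _ => l end).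
assert (Hsg : forall t, tau l <= t <= tau h -> l <= sg t <= h /\ tau (sg t) = t).
{ intros t Ht; unfold sg; destruct (Rle_dec (tau l) t) as [A|A]; [|lra].
  destruct (Rle_dec t (tau h)) as [B|B]; [|lra].
  apply (proj2_sig (Hex t (conj A B))). }
assert (Hinv : forall s, l <= s <= h -> sg (tau s) = s).
{ intros s Hs.
  assert (Hts : tau l <= tau s <= tau h).
  { split; [destruct (Req_dec l s) as [->|N]; [lra|]|destruct (Req_dec s h) as [->|N]; [lra|]];
      apply Rlt_le, Hinc; lra. }
  destruct (Hsg _ Hts) as [B E].
  destruct (Rtotal_order (sg (tau s)) s) as [Lt|[Eq|Gt]]; [|exact Eq|].
  - assert (X := Hinc (sg (tau s)) s ltac:(lra) Lt ltac:(lra)); lra.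
  - assert (X := Hinc s (sg (tau s)) ltac:(lra) Gt ltac:(lra)); lra. }
assert (T0 : tau s1 = 0) by apply (RInt_point (V := R_CompleteNormedModule)).
assert (I1 : tau l < tau s1) by (apply Hinc; lra).
assert (I2 : tau s1 < tau s2) by (apply Hinc; lra).
assert (I3 : tau s2 < tau h) by (apply Hinc; lra).
exists (tau s2), sg; split; [lra|]; split; [rewrite <- T0; apply Hinv; lra|].
split; [apply Hinv; lra|]; split.
- intros t Ht; destruct (Hsg t ltac:(lra)) as [B E]; split; [lra|].
  assert (Prf : forall a, sg (tau l) <= a <= sg (tau h) -> derivable_pt tau a).
  { intros a Ha; rewrite !Hinv in Ha by lra; exists (/ c a); apply is_derive_Reals, Hd; lra. }
  assert (Pr : sg (tau l) <= sg t <= sg (tau h)) by (rewrite !Hinv by lra; exact B).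
  assert (Edp : derive_pt tau (sg t) (Prf (sg t) Pr) = / c (sg t)).
  { apply derive_pt_eq_0, is_derive_Reals, Hd; lra. }
  assert (Pc : 0 < c (sg t)) by (apply Hc; lra).
  assert (Nz : / c (sg t) <> 0) by (apply Rinv_neq_0_compat; lra).
  apply is_derive_Reals.
  replace (c (sg t)) with (1 / derive_pt tau (sg t) (Prf (sg t) Pr)).
  + apply derivable_pt_lim_recip_interv.
    * apply (continuity_pt_recip_prelim tau sg l h Hlh Hinc); [|exact Hct|lra].
      intros x Hx; unfold comp, id; now apply Hinv.
    * lra.
    * lra.
    * intros x Hx; unfold comp, id; now apply Hsg.
    * now rewrite Edp.
  + rewrite Edp; field; lra.
- intros t Ht; destruct (Hsg t ltac:(lra)) as [B E]; split.
  + destruct (Rle_lt_dec (sg t) s1) as [C|C]; [|exact C].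
    destruct (Req_dec (sg t) s1) as [Eq|N]; [rewrite Eq in E; lra|].
    assert (X := Hinc (sg t) s1 ltac:(lra) ltac:(lra) ltac:(lra)); lra.
  + destruct (Rle_lt_dec s2 (sg t)) as [C|C]; [|exact C].
    destruct (Req_dec (sg t) s2) as [Eq|N]; [rewrite Eq in E; lra|].
    assert (X := Hinc s2 (sg t) ltac:(lra) ltac:(lra) ltac:(lra)); lra.
Qed.

(** A curve tangent to the field needs only the right clock: [c] is the speed of the parameter along
    the flow, and [time_change] supplies that clock. *)
Lemma arc_along (S : vfield) (side : R * R -> Prop) (x y dx dy c : R -> R) (lo s1 s2 hi : R) :
  lo < s1 -> s1 < s2 -> s2 < hi ->
  (forall s, lo < s < hi -> continuity_pt c s /\ 0 < c s) ->
  (forall s, lo < s < hi -> is_derive x s (dx s) /\ is_derive y s (dy s)) ->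
  (forall s, lo < s < hi -> S (x s, y s) = (c s * dx s, c s * dy s)) ->
  (forall s, s1 < s < s2 -> side (x s, y s)) ->
  arc S side (x s1, y s1) (x s2, y s2).
Proof.
intros H1 H2 H3 Hc Hd HS Hside.
destruct (time_change c lo s1 s2 hi H1 H2 H3 Hc) as [T [sg [HT [E0 [ET [Hsg Hin]]]]]].
exists T, (fun t => (x (sg t), y (sg t))); split; [exact HT|]; split.
- intros t Ht; destruct (Hsg t Ht) as [Hr Ht']; destruct (Hd _ Hr) as [Dx Dy].
  simpl; rewrite (HS _ Hr); simpl; split.
  + apply (is_derive_comp x sg t (dx (sg t)) (c (sg t)) Dx Ht').
  + apply (is_derive_comp y sg t (dy (sg t)) (c (sg t)) Dy Ht').
- split; [now rewrite E0|]; split; [now rewrite ET|].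
  intros t Ht; apply Hside, Hin, Ht.
Qed.

Lemma arc_along_reverse (S : vfield) (side : R * R -> Prop) (x y dx dy c : R -> R)
  (lo s1 s2 hi : R) :
  lo < s1 -> s1 < s2 -> s2 < hi ->
  (forall s, lo < s < hi -> continuity_pt c s /\ c s < 0) ->
  (forall s, lo < s < hi -> is_derive x s (dx s) /\ is_derive y s (dy s)) ->
  (forall s, lo < s < hi -> S (x s, y s) = (c s * dx s, c s * dy s)) ->
  (forall s, s1 < s < s2 -> side (x s, y s)) ->
  arc S side (x s2, y s2) (x s1, y s1).
Proof.
intros H1 H2 H3 Hc Hd HS Hside.
assert (Hrev : forall f df s, is_derive f (- s) df -> is_derive (fun r => f (- r)) s (- df)).
{ intros f df s Hf; evar_last.
  - apply (is_derive_comp f Ropp s df (-1) Hf); auto_derive; [trivial|ring].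
  - unfold scal; simpl; unfold mult; simpl; ring. }
assert (H := arc_along S side (fun s => x (- s)) (fun s => y (- s)) (fun s => - dx (- s))
  (fun s => - dy (- s)) (fun s => - c (- s)) (- hi) (- s2) (- s1) (- lo)).
cbv beta in H; rewrite !Ropp_involutive in H; apply H; try lra.
- intros s Hs; destruct (Hc (- s)) as [C N]; [lra|]; split; [|lra].
  apply (continuity_pt_opp (fun r => c (- r))), (continuity_pt_comp Ropp c); [|exact C].
  apply continuity_pt_opp, derivable_continuous_pt, derivable_pt_id.
- intros s Hs; destruct (Hd (- s)) as [Dx Dy]; [lra|]; split; now apply Hrev.
- intros s Hs; rewrite HS by lra; f_equal; ring.
- intros s Hs; apply Hside; lra.
Qed.

Definition pullback (S : vfield) (a b c al be ga : R) : vfield := fun p =>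
  let u := fst (S (a * fst p + b * snd p + c, al * fst p + be * snd p + ga)) in
  let v := snd (S (a * fst p + b * snd p + c, al * fst p + be * snd p + ga)) in
  ((be * u - b * v) / (a * be - b * al), (- al * u + a * v) / (a * be - b * al)).

Lemma pullback_in_class (S : vfield) (a b c al be ga : R) :
  b * al - a * be <> 0 -> in_class S (pullback S a b c al be ga).
Proof. intros H; exists a, b, c, al, be, ga; split; [exact H|reflexivity]. Qed.

Ltac lipschitz :=
  repeat first
    [ apply locally_lipschitz_fst | apply locally_lipschitz_snd
    | apply locally_lipschitz_const | apply locally_lipschitz_plus
    | apply locally_lipschitz_minus | apply locally_lipschitz_opp
    | apply locally_lipschitz_mult | apply locally_lipschitz_pow ].

Lemma pullback_lipschitz (S : vfield) (a b c al be ga : R) :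
  lipschitz_field S -> lipschitz_field (pullback S a b c al be ga).
Proof.
intros [H1 H2].
assert (U : locally_lipschitz (fun p => a * fst p + b * snd p + c)) by lipschitz.
assert (V : locally_lipschitz (fun p => al * fst p + be * snd p + ga)) by lipschitz.
assert (F1 := locally_lipschitz_comp _ _ _ H1 U V).
assert (F2 := locally_lipschitz_comp _ _ _ H2 U V).
split; unfold pullback, Rdiv; simpl; lipschitz; assumption.
Qed.

Lemma is_derive_affine (f g : R -> R) (a b c t df dg : R) :
  is_derive f t df -> is_derive g t dg ->
  is_derive (fun s => a * f s + b * g s + c) t (a * df + b * dg).
Proof.
intros Hf Hg; evar_last.
- apply @is_derive_plus; [apply @is_derive_plus|apply @is_derive_const].
  + apply is_derive_scal; exact Hf.
  + apply is_derive_scal; exact Hg.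
- unfold plus, zero; simpl; ring.
Qed.

Lemma solution_pushforward (S : vfield) (a b c al be ga : R) (g : R -> R * R) (T : R) :
  b * al - a * be <> 0 -> solution_on (pullback S a b c al be ga) g T ->
  solution_on S (fun t => (a * fst (g t) + b * snd (g t) + c,
                           al * fst (g t) + be * snd (g t) + ga)) T.
Proof.
intros Hdet Hg t Ht; destruct (Hg t Ht) as [D1 D2]; simpl.
unfold pullback in D1, D2; simpl in D1, D2.
set (z := S _) in *; split; (evar_last; [eapply is_derive_affine; [exact D1|exact D2]|]);
  simpl; field; lra.
Qed.

Lemma arc_pullback (S : vfield) (a b c al be ga : R) (side side' : R * R -> Prop) (p q : R * R) :
  b * al - a * be <> 0 ->
  (forall z, side (a * fst z + b * snd z + c, al * fst z + be * snd z + ga) -> side' z) ->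
  arc S side (a * fst p + b * snd p + c, al * fst p + be * snd p + ga)
             (a * fst q + b * snd q + c, al * fst q + be * snd q + ga) ->
  arc (pullback S a b c al be ga) side' p q.
Proof.
intros Hdet Hside [T [g [HT [Hg [E0 [ET Hin]]]]]].
set (d := a * be - b * al).
assert (Hd : d <> 0) by (unfold d; lra).
(* The inverse affine map applied to [g]. *)
set (k := fun t => (be / d * fst (g t) + (- b / d) * snd (g t) + (b * ga - be * c) / d,
                    - al / d * fst (g t) + a / d * snd (g t) + (al * c - a * ga) / d)).
assert (Hk : forall t, (a * fst (k t) + b * snd (k t) + c,
                        al * fst (k t) + be * snd (k t) + ga) = g t).
{ intros t; rewrite (surjective_pairing (g t)); unfold k; simpl; unfold d in *.
  f_equal; field; lra. }
exists T, k; split; [exact HT|]; split; [|split; [|split]].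
- intros t Ht; destruct (Hg t Ht) as [D1 D2]; unfold pullback; rewrite Hk.
  set (z := S (g t)) in *; split;
    (evar_last; [unfold k; simpl; eapply is_derive_affine; [exact D1|exact D2]|]);
    simpl; unfold d in *; field; lra.
- unfold k; rewrite E0, (surjective_pairing p); simpl; unfold d in *; f_equal; field; lra.
- unfold k; rewrite ET, (surjective_pairing q); simpl; unfold d in *; f_equal; field; lra.
- intros t Ht; apply Hside; rewrite Hk; now apply Hin.
Qed.

Lemma lipschitz_field_ext (F : vfield) (f g : R * R -> R) :
  (forall x y, F (x, y) = (f (x, y), g (x, y))) ->
  locally_lipschitz f -> locally_lipschitz g -> lipschitz_field F.
Proof.
intros HF Hf Hg; split; intros M;
  [destruct (Hf M) as [L [PL HL]]|destruct (Hg M) as [L [PL HL]]];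
  exists L; (split; [exact PL|]); intros [x y] [x' y'] H1 H2 H3 H4; rewrite !HF;
  now apply HL.
Qed.

Lemma solution_coordinates (F : vfield) (f g : R -> R -> R) (k : R -> R * R) (T : R) :
  (forall x y, F (x, y) = (f x y, g x y)) -> solution_on F k T ->
  forall t, 0 <= t <= T ->
    is_derive (fun t => fst (k t)) t (f (fst (k t)) (snd (k t))) /\
    is_derive (fun t => snd (k t)) t (g (fst (k t)) (snd (k t))).
Proof.
intros HF Hk t Ht; destruct (Hk t Ht) as [D1 D2].
destruct (k t) as [x y] eqn:E; rewrite HF in D1, D2; now split.
Qed.

(** * Isolated crossing orbits *)

Definition right_half (z : R * R) : Prop := fst z > 0.
Definition left_half (z : R * R) : Prop := fst z < 0.

(** If one return time were smaller, the other solution would coincide with the first up to that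
    time and so meet the line at an interior time. *)
Lemma first_return_unique (F : vfield) (g h : R -> R * R) (T T' : R) :
  lipschitz_field F -> 0 < T -> 0 < T' -> solution_on F g T -> solution_on F h T' ->
  g 0 = h 0 -> fst (g T) = 0 -> fst (h T') = 0 ->
  (forall t, 0 < t < T -> fst (g t) <> 0) -> (forall t, 0 < t < T' -> fst (h t) <> 0) ->
  T = T' /\ forall t, 0 <= t <= T -> g t = h t.
Proof.
intros HF HT HT' Hg Hh E0 Eg Eh Ng Nh.
assert (Hres : forall k (A B : R), A <= B -> solution_on F k B -> solution_on F k A)
  by (intros k A B HAB Hk t Ht; apply Hk; lra).
destruct (Rtotal_order T T') as [Lt|[<-|Gt]].
- exfalso; apply (Nh T); [lra|].
  rewrite <- (solution_unique F g h T HF); auto; [lra|now apply (Hres h T T'); [lra|]|lra].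
- split; [reflexivity|]; apply (solution_unique F g h T HF); auto; lra.
- exfalso; apply (Ng T'); [lra|].
  rewrite (solution_unique F g h T' HF); auto; [lra|now apply (Hres g T' T); [lra|]|lra].
Qed.

Lemma initial_slope_nonneg (u : R -> R) (l T : R) :
  0 < T -> is_derive u 0 l -> u 0 = 0 -> (forall t, 0 < t < T -> 0 < u t) -> 0 <= l.
Proof.
intros HT Hd E0 Hp; destruct (Rle_lt_dec 0 l) as [H|H]; [exact H|exfalso].
apply is_derive_Reals in Hd; destruct (Hd (- l) ltac:(lra)) as [del Hdel].
assert (Pd := cond_pos del).
set (t := Rmin (T / 2) (del / 2)).
assert (Ht : 0 < t /\ t <= T / 2 /\ t <= del / 2).
{ unfold t; split; [apply Rmin_glb_lt; lra|]; split; [apply Rmin_l|apply Rmin_r]. }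
specialize (Hdel t ltac:(lra)); rewrite Rabs_pos_eq in Hdel by lra.
specialize (Hdel ltac:(lra)); rewrite Rplus_0_l, E0, Rminus_0_r in Hdel.
apply Rabs_def2 in Hdel.
assert (0 < u t / t) by (apply Rdiv_lt_0_compat; [apply Hp; lra|lra]); lra.
Qed.

(** This orients a competitor: its right arc cannot start at the end where the field points to the
    left. *)
Lemma arc_right_start (F : vfield) (y : R) (q : R * R) :
  arc F right_half (0, y) q -> 0 <= fst (F (0, y)).
Proof.
intros [T [g [HT [Hg [E0 [_ Hp]]]]]].
apply (initial_slope_nonneg (fun t => fst (g t)) _ T HT).
- rewrite <- E0; apply (Hg 0); lra.
- now rewrite E0.
- intros t Ht; apply Rgt_lt, Hp, Ht.
Qed.

Lemma list_gap (L : list R) (y : R) :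
  exists eps, 0 < eps /\ forall z, In z L -> z <> y -> eps <= Rabs (z - y).
Proof.
induction L as [|a L [e [He IH]]].
- exists 1; split; [lra|]; intros z [].
- destruct (Req_dec a y) as [->|N].
  + exists e; split; [exact He|]; intros z [<-|Hz] Hne; [easy|now apply IH].
  + assert (P : 0 < Rabs (a - y)) by (apply Rabs_pos_lt; lra).
    exists (Rmin e (Rabs (a - y))); split; [now apply Rmin_glb_lt|].
    intros z [<-|Hz] Hne; [apply Rmin_r|eapply Rle_trans; [apply Rmin_l|now apply IH]].
Qed.

(** A competitor close to the cycle has its ends in [L], hence in [a], [b] once the rest of [L] is
    cut out. The direction of the field fixes their order, and uniqueness makes both arcs coincide.
    The points of the cycle on the line are recorded in order to tell different cycles apart. *)
Lemma limit_cycle_of_arcs (Fp Fm : vfield) (lo hi : R) (L : list R) (a b : R) :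
  lipschitz_field Fp -> lipschitz_field Fm ->
  arc Fp right_half (0, a) (0, b) -> arc Fm left_half (0, b) (0, a) ->
  0 < fst (Fp (0, a)) -> 0 < fst (Fm (0, a)) ->
  fst (Fp (0, b)) < 0 -> fst (Fm (0, b)) < 0 ->
  lo < a < hi -> lo < b < hi ->
  (forall y1 y2, lo < y1 < hi -> lo < y2 < hi -> y1 <> y2 ->
     arc Fp right_half (0, y1) (0, y2) -> arc Fm left_half (0, y2) (0, y1) ->
     In y1 L /\ In y2 L) ->
  exists G, crossing_limit_cycle Fp Fm G /\ forall y, G (0, y) <-> y = a \/ y = b.
Proof.
intros HFp HFm [T1 [g1 [HT1 [Hg1 [E10 [E1T P1]]]]]] [T2 [g2 [HT2 [Hg2 [E20 [E2T P2]]]]]].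
intros Xpa Xma Xpb Xmb Ha Hb Hfin.
assert (Hab : a <> b) by (intros E; rewrite E in Xpa; lra).
set (G := fun z => (exists t, 0 <= t <= T1 /\ z = g1 t) \/ (exists t, 0 <= t <= T2 /\ z = g2 t)).
assert (HG : forall y, G (0, y) <-> y = a \/ y = b).
{ intros y; split.
  - intros [[t [Ht E]]|[t [Ht E]]].
    + destruct (Req_dec t 0) as [->|N0]; [rewrite E10 in E; left; congruence|].
      destruct (Req_dec t T1) as [->|NT]; [rewrite E1T in E; right; congruence|].
      assert (P := P1 t ltac:(lra)); unfold right_half in P; rewrite <- E in P; simpl in P; lra.
    + destruct (Req_dec t 0) as [->|N0]; [rewrite E20 in E; right; congruence|].
      destruct (Req_dec t T2) as [->|NT]; [rewrite E2T in E; left; congruence|].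
      assert (P := P2 t ltac:(lra)); unfold left_half in P; rewrite <- E in P; simpl in P; lra.
  - intros [->| ->]; left; [exists 0|exists T1]; split; auto; lra. }
exists G; split; [split|exact HG].
- exists a, b, T1, T2, g1, g2; unfold crossing_point.
  assert (0 < fst (Fp (0, a)) * fst (Fm (0, a))) by now apply Rmult_lt_0_compat.
  assert (0 < (- fst (Fp (0, b))) * (- fst (Fm (0, b)))) by (apply Rmult_lt_0_compat; lra).
  assert (fst (Fp (0, b)) * fst (Fm (0, b)) > 0) by lra.
  repeat match goal with |- _ /\ _ => split end; auto.
  intros z; reflexivity.
(* Only the trace on the switching line is restricted: the open interval from [lo] to [hi], without
   the listed points other than [a] and [b]. It is open because [L] is finite. *)
- exists (fun z => fst z <> 0 \/ (lo < snd z < hi /\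
    forall y, In y L -> y <> a -> y <> b -> y <> snd z)).
  split; [|split].
  + intros [zx zy] [Hz|[Hz HzL]]; simpl in *.
    * exists (Rabs zx); split; [now apply Rabs_pos_lt|].
      intros [wx wy] Hw _; left; simpl in *; intros ->.
      replace (0 - zx) with (- zx) in Hw by ring; rewrite Rabs_Ropp in Hw; lra.
    * destruct (list_gap L zy) as [e [He HeL]].
      exists (Rmin e (Rmin (zy - lo) (hi - zy))); split.
      { repeat apply Rmin_glb_lt; lra. }
      intros [wx wy] _ Hw; right; simpl in *.
      assert (M1 := Rmin_l e (Rmin (zy - lo) (hi - zy))).
      assert (M2 := Rmin_r e (Rmin (zy - lo) (hi - zy))).
      assert (M3 := Rmin_l (zy - lo) (hi - zy)); assert (M4 := Rmin_r (zy - lo) (hi - zy)).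
      split; [apply Rabs_def2 in Hw; lra|].
      intros y Hy Hya Hyb ->; assert (Q := HeL wy Hy (HzL wy Hy Hya Hyb)); lra.
  + intros [zx zy] Hz; destruct (Req_dec zx 0) as [->|N]; [right|now left]; simpl.
    apply HG in Hz; destruct Hz as [->| ->]; split; auto.
  + intros G' [y1 [y2 [S1 [S2 [k1 [k2 [Hne [_ [_ [HS1 [HS2 [Hk1 [F10 [F1T [Q1
      [Hk2 [F20 [F2T [Q2 HG']]]]]]]]]]]]]]]]]]] HU.
    assert (A1 : arc Fp right_half (0, y1) (0, y2)) by (exists S1, k1; auto).
    assert (A2 : arc Fm left_half (0, y2) (0, y1)) by (exists S2, k2; auto).
    assert (U1 : lo < y1 < hi /\ forall y, In y L -> y <> a -> y <> b -> y <> y1).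
    { destruct (HU (0, y1)) as [N|H]; [|now destruct N|exact H].
      apply HG'; left; exists 0; split; [lra|auto]. }
    assert (U2 : lo < y2 < hi /\ forall y, In y L -> y <> a -> y <> b -> y <> y2).
    { destruct (HU (0, y2)) as [N|H]; [|now destruct N|exact H].
      apply HG'; left; exists S1; split; [lra|auto]. }
    destruct U1 as [B1 U1], U2 as [B2 U2].
    destruct (Hfin y1 y2 B1 B2 Hne A1 A2) as [I1 I2].
    assert (D1 : y1 = a \/ y1 = b).
    { destruct (Req_dec y1 a); [now left|]; destruct (Req_dec y1 b); [now right|].
      exfalso; now apply (U1 y1). }
    assert (D2 : y2 = a \/ y2 = b).
    { destruct (Req_dec y2 a); [now left|]; destruct (Req_dec y2 b); [now right|].
      exfalso; now apply (U2 y2). }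
    assert (Ey1 : y1 = a).
    { destruct D1 as [E|E]; [exact E|]; assert (X := arc_right_start _ _ _ A1).
      rewrite E in X; lra. }
    assert (Ey2 : y2 = b) by (destruct D2 as [E|E]; [congruence|exact E]).
    subst y1 y2.
    destruct (first_return_unique Fp g1 k1 T1 S1) as [ET1 EK1]; auto; try congruence.
    { now rewrite E1T. } { now rewrite F1T. }
    { intros t Ht; assert (P := P1 t Ht); unfold right_half in P; lra. }
    { intros t Ht; assert (P := Q1 t Ht); lra. }
    destruct (first_return_unique Fm g2 k2 T2 S2) as [ET2 EK2]; auto; try congruence.
    { now rewrite E2T. } { now rewrite F2T. }
    { intros t Ht; assert (P := P2 t Ht); unfold left_half in P; lra. }
    { intros t Ht; assert (P := Q2 t Ht); lra. }
    subst S1 S2.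
    intros z; rewrite HG'; split; intros [[t [Ht E]]|[t [Ht E]]].
    * left; exists t; rewrite EK1; auto.
    * right; exists t; rewrite EK2; auto.
    * left; exists t; rewrite <- EK1; auto.
    * right; exists t; rewrite <- EK2; auto.
Qed.

(** The pairs allowed by one side are [A m], [B m], and [Phi] is the condition of the other side.
    Existence is needed only for [m] between [m0] and [m3], but a competitor may have its parameter
    anywhere in [dom], so finiteness of the zeros is asked there. *)
Lemma three_limit_cycles (Fp Fm : vfield) (lo hi : R) (dom : R -> Prop) (A B Phi : R -> R)
  (m0 m1 m2 m3 : R) :
  lipschitz_field Fp -> lipschitz_field Fm ->
  (exists L, forall m, dom m -> Phi m = 0 -> In m L) ->
  (forall y1 y2, lo < y1 < hi -> lo < y2 < hi -> y1 <> y2 ->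
     arc Fp right_half (0, y1) (0, y2) -> arc Fm left_half (0, y2) (0, y1) ->
     exists m, dom m /\ Phi m = 0 /\ (y1 = A m /\ y2 = B m \/ y1 = B m /\ y2 = A m)) ->
  (forall m, m0 < m < m3 -> lo < A m < hi /\ lo < B m < hi) ->
  (forall m, m0 < m < m3 -> Phi m = 0 ->
     arc Fp right_half (0, A m) (0, B m) /\ arc Fm left_half (0, B m) (0, A m)) ->
  (forall m, m0 < m < m3 -> Phi m = 0 ->
     0 < fst (Fp (0, A m)) /\ 0 < fst (Fm (0, A m)) /\
     fst (Fp (0, B m)) < 0 /\ fst (Fm (0, B m)) < 0) ->
  (forall m m', m0 < m -> m < m' -> m' < m3 -> A m <> A m') ->
  m0 < m1 -> m1 < m2 -> m2 < m3 ->
  (exists m, m0 < m < m1 /\ Phi m = 0) -> (exists m, m1 < m < m2 /\ Phi m = 0) ->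
  (exists m, m2 < m < m3 /\ Phi m = 0) ->
  has_three_crossing_limit_cycles Fp Fm.
Proof.
intros HFp HFm [L HL] Hpar Hdom Harc Hsign Hinj H01 H12 H23 [p [Hp Zp]] [q [Hq Zq]] [r [Hr Zr]].
assert (HG : forall m, m0 < m < m3 -> Phi m = 0 ->
  exists G, crossing_limit_cycle Fp Fm G /\ forall y, G (0, y) <-> y = A m \/ y = B m).
{ intros m Hm Zm; destruct (Hdom m Hm) as [DA DB], (Harc m Hm Zm) as [A1 A2],
    (Hsign m Hm Zm) as [X1 [X2 [X3 X4]]].
  apply (limit_cycle_of_arcs Fp Fm lo hi (map A L ++ map B L)); auto.
  intros y1 y2 B1 B2 Hne R1 R2.
  destruct (Hpar y1 y2 B1 B2 Hne R1 R2) as [n [Dn [Zn E]]].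
  assert (IA := in_map A L n (HL n Dn Zn)); assert (IB := in_map B L n (HL n Dn Zn)).
  destruct E as [[-> ->]|[-> ->]]; split; apply in_or_app; auto. }
(* Two cycles differ already on the line: [A m] is not [A m'] by injectivity, and not [B m'] because
   the right field points in opposite directions at these points. *)
assert (Hdist : forall m m' G G', m0 < m -> m < m' -> m' < m3 -> Phi m = 0 -> Phi m' = 0 ->
  (forall y, G (0, y) <-> y = A m \/ y = B m) ->
  (forall y, G' (0, y) <-> y = A m' \/ y = B m') -> ~ same_set G G').
{ intros m m' G G' K1 K2 K3 Z Z' E E' S.
  assert (I : G' (0, A m)) by (apply S, E; now left).
  apply E' in I; destruct I as [I|I]; [now apply (Hinj m m')|].
  destruct (Hsign m ltac:(lra) Z) as [X _], (Hsign m' ltac:(lra) Z') as [_ [_ [X' _]]].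
  rewrite I in X; lra. }
destruct (HG p ltac:(lra) Zp) as [Gp [Cp Ep]], (HG q ltac:(lra) Zq) as [Gq [Cq Eq]],
  (HG r ltac:(lra) Zr) as [Gr [Cr Er]].
exists Gp, Gq, Gr; split; [exact Cp|split; [exact Cq|split; [exact Cr|split; [|split]]]].
- apply (Hdist p q); auto; lra.
- apply (Hdist p r); auto; lra.
- apply (Hdist q r); auto; lra.
Qed.

(** * S3 and S4 *)

Definition Se (e : R) : vfield := fun p => let (x, y) := p in
  (- y * (1 - 3 * e * x ^ 2), x - 2 * e * x ^ 3 + 9 * e * x * y ^ 2).

Lemma S3_Se : S3 = Se 1.
Proof. apply functional_extensionality; intros [x y]; simpl; f_equal; ring. Qed.

Lemma S4_Se : S4 = Se (-1).
Proof. apply functional_extensionality; intros [x y]; simpl; f_equal; ring. Qed.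

Lemma Se_lipschitz (e : R) : lipschitz_field (Se e).
Proof.
apply (lipschitz_field_ext (Se e)
  (fun p => - snd p * (1 - 3 * e * fst p ^ 2))
  (fun p => fst p - 2 * e * fst p ^ 3 + 9 * e * fst p * snd p ^ 2)); [reflexivity| |]; lipschitz.
Qed.

(** The field gives [weight] the cofactor [6 * e * x * y] and, when [e ^ 2 = 1], gives [numer] three
    times that; hence the first integral [numer / weight ^ 3]. For [e = 1] the zeros of [weight] are
    two invariant lines. *)
Definition weight (e x : R) : R := 1 - 3 * e * x ^ 2.
Definition numer (e x y : R) : R := y ^ 2 + 4 * e / 27 - x ^ 2 / 3.

Lemma Se_first_integral (e : R) (k : R -> R * R) (T : R) : e = 1 \/ e = -1 ->
  0 <= T -> solution_on (Se e) k T ->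
  numer e (fst (k 0)) (snd (k 0)) * weight e (fst (k T)) ^ 3 =
  numer e (fst (k T)) (snd (k T)) * weight e (fst (k 0)) ^ 3.
Proof.
intros He HT Hk.
assert (D := solution_coordinates (Se e) (fun x y => - y * (1 - 3 * e * x ^ 2))
  (fun x y => x - 2 * e * x ^ 3 + 9 * e * x * y ^ 2) k T (fun x y => eq_refl) Hk); cbv beta in D.
set (X := fun t => fst (k t)) in D; set (Y := fun t => snd (k t)) in D.
change (forall t, 0 <= t <= T -> is_derive X t (- Y t * (1 - 3 * e * X t ^ 2)) /\
  is_derive Y t (X t - 2 * e * X t ^ 3 + 9 * e * X t * Y t ^ 2)) in D.
change (numer e (X 0) (Y 0) * weight e (X T) ^ 3 = numer e (X T) (Y T) * weight e (X 0) ^ 3).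
clearbody X Y.
assert (D' : forall t, 0 <= t <= T ->
  Derive (fun t => X t) t = - Y t * (1 - 3 * e * X t ^ 2) /\
  Derive (fun t => Y t) t = X t - 2 * e * X t ^ 3 + 9 * e * X t * Y t ^ 2)
  by (intros t Ht; destruct (D t Ht); split; now apply is_derive_unique).
apply (cofactor_proportional (fun t => numer e (X t) (Y t)) (fun t => weight e (X t) ^ 3)
  (fun t => 18 * e * X t * Y t) T HT).
- intros t Ht; destruct (D t Ht) as [D1 D2], (D' t Ht) as [E1 E2]; unfold numer; auto_derive.
  + repeat split; eexists; eassumption.
  + rewrite E1, E2.
    destruct He as [-> | ->]; field.
- intros t Ht; destruct (D t Ht) as [D1 D2], (D' t Ht) as [E1 E2]; unfold weight; auto_derive.
  + repeat split; eexists; eassumption.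
  + rewrite E1; simpl; ring.
- intros t Ht; destruct (D t Ht) as [D1 D2], (D' t Ht) as [E1 E2].
  apply (is_derive_continuity_pt _ t (18 * e * ((- Y t * (1 - 3 * e * X t ^ 2)) * Y t +
     X t * (X t - 2 * e * X t ^ 3 + 9 * e * X t * Y t ^ 2)))).
  auto_derive.
  + repeat split; eexists; eassumption.
  + rewrite E1, E2; ring.
Qed.

(** Supplies the margin beyond both ends that [arc_along] requires. *)
Lemma positive_extends (f : R -> R) (x1 x2 : R) : continuity f -> x1 <= x2 ->
  (forall x, x1 <= x <= x2 -> 0 < f x) ->
  exists d, 0 < d /\ forall x, x1 - d < x < x2 + d -> 0 < f x.
Proof.
intros Hf Hx Hp.
assert (Hloc : forall a, 0 < f a -> exists d, 0 < d /\ forall x, Rabs (x - a) < d -> 0 < f x).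
{ intros a Ha; destruct (Hf a (f a) Ha) as [d [Hd H]]; exists d; split; [exact Hd|].
  intros x Hxa; destruct (Req_dec x a) as [->|N]; [exact Ha|].
  assert (Q : Rabs (f x - f a) < f a).
  { apply H; split; [split; [exact I|now apply not_eq_sym]|exact Hxa]. }
  apply Rabs_def2 in Q; lra. }
destruct (Hloc x1 (Hp x1 ltac:(lra))) as [d1 [P1 H1]].
destruct (Hloc x2 (Hp x2 ltac:(lra))) as [d2 [P2 H2]].
exists (Rmin d1 d2); split; [now apply Rmin_glb_lt|].
assert (M1 := Rmin_l d1 d2); assert (M2 := Rmin_r d1 d2).
intros x Hxx; destruct (Rle_lt_dec x1 x) as [A|A], (Rle_lt_dec x x2) as [B|B].
- apply Hp; lra.
- apply H2; rewrite Rabs_pos_eq; lra.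
- apply H1; rewrite Rabs_left; lra.
- apply H1; rewrite Rabs_left; lra.
Qed.

(** The last hypothesis lets [dh] change sign at most once, upwards, and equal end values force an
    interior zero. In the applications the end signs say that the flow crosses the line in opposite
    directions there. *)
Lemma single_crossing_ends (h dh : R -> R) (x1 x2 : R) : x1 < x2 ->
  (forall x, x1 <= x <= x2 -> is_derive h x (dh x)) -> h x1 = h x2 ->
  (forall u v, x1 <= u -> u < v -> v <= x2 -> 0 <= dh u -> 0 < dh v) ->
  dh x1 < 0 < dh x2.
Proof.
intros Hx Hd Heq Hcross.
destruct (MVT_cor2 h dh x1 x2 Hx) as [z [E Hz]].
- intros x Hxx; apply is_derive_Reals, Hd, Hxx.
- assert (Z : dh z = 0) by (apply (Rmult_eq_reg_r (x2 - x1)); lra).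
  split.
  + destruct (Rle_lt_dec 0 (dh x1)) as [P|P]; [|exact P].
    assert (Q := Hcross x1 z ltac:(lra) ltac:(lra) ltac:(lra) P); lra.
  + apply (Hcross z x2); lra.
Qed.

(** Otherwise a nonnegative mean slope on the left of [x] would be followed by a nonpositive one on
    its right. This places the arc on one side of the line without any convexity. *)
Lemma single_crossing_below (h dh : R -> R) (x1 x2 : R) :
  (forall x, x1 <= x <= x2 -> is_derive h x (dh x)) -> h x1 = h x2 ->
  (forall u v, x1 <= u -> u < v -> v <= x2 -> 0 <= dh u -> 0 < dh v) ->
  forall x, x1 < x < x2 -> h x < h x1.
Proof.
intros Hd Heq Hcross x Hxx; destruct (Rlt_le_dec (h x) (h x1)) as [P|P]; [exact P|exfalso].
destruct (MVT_cor2 h dh x1 x) as [u [Eu Hu]]; [lra| |].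
{ intros y Hy; apply is_derive_Reals, Hd; lra. }
destruct (MVT_cor2 h dh x x2) as [v [Ev Hv]]; [lra| |].
{ intros y Hy; apply is_derive_Reals, Hd; lra. }
assert (U : 0 <= dh u).
{ apply (Rmult_le_reg_r (x - x1)); lra. }
assert (V := Hcross u v ltac:(lra) ltac:(lra) ltac:(lra) U).
assert (0 < dh v * (x2 - x)) by (apply Rmult_lt_0_compat; lra); lra.
Qed.

(* [slope_num / weight^4] is the derivative of [numer / weight^3] along the line [y = g + s x];
   it is also twice the speed at which the flow crosses that line upwards. *)
Definition slope_num (e g s x : R) : R :=
  (2 * s * (g + s * x) - 2 * x / 3) * weight e x + 18 * e * x * numer e x (g + s * x).

Lemma Se_crossing_speed (e g s x : R) : e = 1 \/ e = -1 ->
  snd (Se e (x, g + s * x)) - s * fst (Se e (x, g + s * x)) = slope_num e g s x / 2.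
Proof. intros [-> | ->]; unfold slope_num, weight, numer; simpl; field. Qed.

(** On a level of the first integral [y ^ 2] is a polynomial in [x], so the orbit above the line is
    a graph. As [x' = - y * weight] and [y > 0], the sign [sg] of the weight decides the direction
    of travel. *)
Lemma Se_graph_arc (e g s sg x1 x2 : R) : e = 1 \/ e = -1 -> sg = 1 \/ sg = -1 -> x1 < x2 ->
  (forall x, x1 <= x <= x2 -> 0 < sg * weight e x) ->
  (forall x, x1 <= x <= x2 -> 0 < g + s * x) ->
  numer e x1 (g + s * x1) * weight e x2 ^ 3 = numer e x2 (g + s * x2) * weight e x1 ^ 3 ->
  (forall u v, x1 <= u -> u < v -> v <= x2 ->
     0 <= sg * slope_num e g s u -> 0 < sg * slope_num e g s v) ->
  sg * slope_num e g s x1 < 0 < sg * slope_num e g s x2 /\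
  (sg = 1 -> arc (Se e) (fun p => g + s * fst p < snd p) (x2, g + s * x2) (x1, g + s * x1)) /\
  (sg = -1 -> arc (Se e) (fun p => g + s * fst p < snd p) (x1, g + s * x1) (x2, g + s * x2)).
Proof.
intros He Hsg Hx HW Hl Hrel HK.
assert (Esg : sg * sg = 1) by (destruct Hsg as [-> | ->]; ring).
set (w := weight e) in *; set (K := slope_num e g s) in *.
set (N := fun x => numer e x (g + s * x)).
(* The factor [sg] makes [h] go down and then up between the ends for either sign of the weight. *)
set (h := fun x => sg * (N x / w x ^ 3)).
set (dh := fun x => sg * (K x / w x ^ 4)).
assert (Wn : forall x, x1 <= x <= x2 -> w x <> 0).
{ intros x Hxx E; assert (P := HW x Hxx); rewrite E in P; lra. }
assert (W4 : forall x, x1 <= x <= x2 -> 0 < / w x ^ 4).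
{ intros x Hxx; apply Rinv_0_lt_compat; replace (w x ^ 4) with ((sg * w x) ^ 4).
  - now apply pow_lt, HW.
  - replace ((sg * w x) ^ 4) with ((sg * sg) ^ 2 * w x ^ 4) by ring; rewrite Esg; ring. }
assert (Hd : forall x, x1 <= x <= x2 -> is_derive h x (dh x)).
{ intros x Hxx; assert (P := Wn x Hxx); unfold h, dh, N, K, slope_num, w, weight, numer in *.
  auto_derive; [repeat split; auto|]; [now apply (pow_nonzero _ 3) in P|].
  simpl; field; intros E; apply P; rewrite <- E; ring. }
assert (Heq : h x1 = h x2).
{ unfold h; f_equal; fold (N x1) in Hrel; fold (N x2) in Hrel.
  assert (P1 := Wn x1 ltac:(lra)); assert (P2 := Wn x2 ltac:(lra)).
  apply (Rmult_eq_reg_r (w x1 ^ 3 * w x2 ^ 3)).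
  - replace (N x1 / w x1 ^ 3 * (w x1 ^ 3 * w x2 ^ 3)) with (N x1 * w x2 ^ 3) by (field; auto).
    replace (N x2 / w x2 ^ 3 * (w x1 ^ 3 * w x2 ^ 3)) with (N x2 * w x1 ^ 3) by (field; auto).
    exact Hrel.
  - apply Rmult_integral_contrapositive_currified; now apply pow_nonzero. }
assert (Hcross : forall u v, x1 <= u -> u < v -> v <= x2 -> 0 <= dh u -> 0 < dh v).
{ intros u v Hu Huv Hv Pu; unfold dh in *.
  assert (A := W4 u ltac:(lra)); assert (B := W4 v ltac:(lra)).
  replace (sg * (K u / w u ^ 4)) with ((sg * K u) * / w u ^ 4) in Pu by (unfold Rdiv; ring).
  replace (sg * (K v / w v ^ 4)) with ((sg * K v) * / w v ^ 4) by (unfold Rdiv; ring).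
  apply Rmult_lt_0_compat; [|exact B]; apply (HK u v); try assumption.
  apply (Rmult_le_reg_r (/ w u ^ 4)); [exact A|]; lra. }
split.
{ destruct (single_crossing_ends h dh x1 x2 Hx Hd Heq Hcross) as [A B].
  assert (P1 := W4 x1 ltac:(lra)); assert (P2 := W4 x2 ltac:(lra)).
  unfold dh, Rdiv in A, B; rewrite <- Rmult_assoc in A, B; split.
  - apply (Rmult_lt_reg_r (/ w x1 ^ 4)); [exact P1|]; lra.
  - apply (Rmult_lt_reg_r (/ w x2 ^ 4)); [exact P2|]; lra. }
set (kap := N x1 / w x1 ^ 3).
(* This is [y ^ 2] solved from [numer = kap * weight ^ 3]. It exceeds the square of the height of
   the line exactly by [kap * w x ^ 3 - N x], whose sign comes from [single_crossing_below]. *)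
set (Y := fun x => kap * w x ^ 3 - 4 * e / 27 + x ^ 2 / 3).
assert (YE : forall x, Y x = (g + s * x) ^ 2 + (kap * w x ^ 3 - N x))
  by (intros x; unfold Y, N, numer; field).
assert (Y1 : Y x1 = (g + s * x1) ^ 2).
{ rewrite YE; unfold kap; field; apply Wn; lra. }
assert (Y2 : Y x2 = (g + s * x2) ^ 2).
{ rewrite YE; replace kap with (N x2 / w x2 ^ 3); [field; apply Wn; lra|].
  unfold h in Heq; fold kap in Heq.
  apply (Rmult_eq_reg_l sg); [symmetry; exact Heq|]; intros E; rewrite E in Esg; lra. }
assert (Yin : forall x, x1 < x < x2 -> (g + s * x) ^ 2 < Y x).
{ intros x Hxx; assert (B := single_crossing_below h dh x1 x2 Hd Heq Hcross x Hxx).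
  unfold h in B; fold kap in B; rewrite YE.
  assert (P := Wn x ltac:(lra)); assert (Q := pow_lt _ 3 (HW x ltac:(lra))).
  assert (R : 0 < (sg * kap - sg * (N x / w x ^ 3)) * (sg * w x) ^ 3)
    by (apply Rmult_lt_0_compat; lra).
  replace ((sg * kap - sg * (N x / w x ^ 3)) * (sg * w x) ^ 3) with
    ((sg * sg) ^ 2 * (kap * w x ^ 3 - N x)) in R by (field; exact P).
  rewrite Esg in R; lra. }
assert (Ypos : forall x, x1 <= x <= x2 -> 0 < Y x).
{ intros x Hxx; assert (P := pow_lt _ 2 (Hl x Hxx)).
  destruct (Req_dec x x1) as [->|N1]; [now rewrite Y1|].
  destruct (Req_dec x x2) as [->|N2]; [now rewrite Y2|].
  assert (Q := Yin x ltac:(lra)); lra. }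
assert (Wpoly : polynomial w).
{ unfold w, weight; apply polynomial_minus; [apply polynomial_const|].
  apply polynomial_mult; [apply polynomial_const|apply polynomial_pow, polynomial_id]. }
assert (Ypoly : polynomial Y).
{ unfold Y, Rdiv; apply polynomial_plus; [apply polynomial_minus|].
  - apply polynomial_mult; [apply polynomial_const|now apply polynomial_pow].
  - apply polynomial_const.
  - apply polynomial_mult; [apply polynomial_pow, polynomial_id|apply polynomial_const]. }
destruct (positive_extends Y x1 x2 (polynomial_continuity _ Ypoly) ltac:(lra) Ypos) as [d1 [P1 H1]].
destruct (positive_extends (fun x => sg * w x) x1 x2) as [d2 [P2 H2]]; [|lra|exact HW|].
{ apply polynomial_continuity, polynomial_mult; [apply polynomial_const|exact Wpoly]. }
set (d := Rmin d1 d2).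
assert (Pd : 0 < d) by now apply Rmin_glb_lt.
assert (M1 : d <= d1) by apply Rmin_l; assert (M2 : d <= d2) by apply Rmin_r.
set (dY := fun x => - 18 * e * kap * x * w x ^ 2 + 2 * x / 3).
assert (DY : forall x, is_derive Y x (dY x)).
{ intros x; unfold Y, dY, w, weight; auto_derive; [trivial|]; simpl; field. }
assert (Hder : forall x, x1 - d < x < x2 + d ->
  is_derive (fun x => x) x 1 /\ is_derive (fun x => sqrt (Y x)) x (dY x / (2 * sqrt (Y x)))).
{ intros x Hxx; assert (P := H1 x ltac:(lra)); split; [apply @is_derive_id|].
  apply is_derive_sqrt; [apply DY|exact P]. }
set (c := fun x => - (sqrt (Y x) * w x)).
assert (Hcont : forall x, x1 - d < x < x2 + d -> continuity_pt c x).
{ intros x Hxx; apply (continuity_pt_opp (fun x => sqrt (Y x) * w x)), continuity_pt_mult.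
  - destruct (Hder x Hxx) as [_ D]; exact (is_derive_continuity_pt _ _ _ D).
  - now apply polynomial_continuity. }
assert (Hfield : forall x, x1 - d < x < x2 + d ->
  Se e (x, sqrt (Y x)) = (c x * 1, c x * (dY x / (2 * sqrt (Y x))))).
{ intros x Hxx; assert (P := H1 x ltac:(lra)); assert (Q := sqrt_lt_R0 _ P).
  assert (S2 : sqrt (Y x) ^ 2 = Y x) by (apply pow2_sqrt; lra).
  unfold Se, c; f_equal; [unfold w, weight; ring|].
  rewrite S2; transitivity (- (w x * dY x) / 2); [|field; lra].
  unfold Y, dY, w, weight; destruct He as [-> | ->]; field. }
assert (Hside : forall x, x1 < x < x2 -> g + s * fst (x, sqrt (Y x)) < snd (x, sqrt (Y x))).
{ intros x Hxx; simpl; assert (P := Hl x ltac:(lra)).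
  rewrite <- (sqrt_pow2 (g + s * x)) at 1 by lra.
  apply sqrt_lt_1; [apply pow2_ge_0|apply Rlt_le, Ypos; lra|now apply Yin]. }
assert (S1 : sqrt (Y x1) = g + s * x1) by (rewrite Y1; apply sqrt_pow2, Rlt_le, Hl; lra).
assert (S2 : sqrt (Y x2) = g + s * x2) by (rewrite Y2; apply sqrt_pow2, Rlt_le, Hl; lra).
rewrite <- S1, <- S2; split; intros Es.
- apply (arc_along_reverse (Se e) _ (fun x => x) (fun x => sqrt (Y x)) (fun _ => 1)
    (fun x => dY x / (2 * sqrt (Y x))) c (x1 - d) x1 x2 (x2 + d)); auto; try lra.
  intros x Hxx; split; [now apply Hcont|]; unfold c.
  assert (Q := sqrt_lt_R0 _ (H1 x ltac:(lra))); assert (Z := H2 x ltac:(lra)).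
  rewrite Es in Z; assert (0 < sqrt (Y x) * w x) by (apply Rmult_lt_0_compat; lra); lra.
- apply (arc_along (Se e) _ (fun x => x) (fun x => sqrt (Y x)) (fun _ => 1)
    (fun x => dY x / (2 * sqrt (Y x))) c (x1 - d) x1 x2 (x2 + d)); auto; try lra.
  intros x Hxx; split; [now apply Hcont|]; unfold c.
  assert (Q := sqrt_lt_R0 _ (H1 x ltac:(lra))); assert (Z := H2 x ltac:(lra)).
  rewrite Es in Z; assert (0 < sqrt (Y x) * (- w x)) by (apply Rmult_lt_0_compat; lra); lra.
Qed.

(* On [x = 0] this is the line [y = g + s x] parametrised by [x = b tau + c]; the right half-plane
   lies above it when [al = 1] and below it when [al = -1]. *)
Definition line_pullback (e b c al s g : R) : vfield :=
  pullback (Se e) 0 b c al (s * b) (s * c + g).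

Lemma line_pullback_lipschitz (e b c al s g : R) : lipschitz_field (line_pullback e b c al s g).
Proof. apply pullback_lipschitz, Se_lipschitz. Qed.

Lemma line_pullback_in_class (e b c al s g : R) : b * al <> 0 ->
  in_class (Se e) (line_pullback e b c al s g).
Proof. intros H; apply pullback_in_class; lra. Qed.

Lemma line_pullback_speed (e b c al s g t : R) : e = 1 \/ e = -1 -> al = 1 \/ al = -1 -> b <> 0 ->
  fst (line_pullback e b c al s g (0, t)) = al * slope_num e g s (b * t + c) / 2.
Proof.
intros He Hal Hb; unfold line_pullback, pullback; simpl fst at 1.
change (fst (0, t)) with 0; change (snd (0, t)) with t.
replace (0 * 0 + b * t + c) with (b * t + c) by ring.
replace (al * 0 + s * b * t + (s * c + g)) with (g + s * (b * t + c)) by ring.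
assert (H := Se_crossing_speed e g s (b * t + c) He).
set (p := Se e (b * t + c, g + s * (b * t + c))) in *.
replace (al * slope_num e g s (b * t + c) / 2) with (al * (snd p - s * fst p))
  by (rewrite H; field).
destruct Hal as [-> | ->]; simpl; field; lra.
Qed.

Lemma line_pullback_relation (e b c al s g : R) (side : R * R -> Prop) (t1 t2 : R) :
  e = 1 \/ e = -1 -> b * al <> 0 -> arc (line_pullback e b c al s g) side (0, t1) (0, t2) ->
  numer e (b * t1 + c) (g + s * (b * t1 + c)) * weight e (b * t2 + c) ^ 3 =
  numer e (b * t2 + c) (g + s * (b * t2 + c)) * weight e (b * t1 + c) ^ 3.
Proof.
intros He Hb [T [k [HT [Hk [E0 [ET _]]]]]].
assert (Hdet : b * al - 0 * (s * b) <> 0) by lra.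
assert (H := Se_first_integral e _ T He (Rlt_le _ _ HT)
  (solution_pushforward (Se e) 0 b c al (s * b) (s * c + g) k T Hdet Hk)).
cbn [fst snd] in H; rewrite E0, ET in H; cbn [fst snd] in H.
replace (0 * 0 + b * t1 + c) with (b * t1 + c) in H by ring.
replace (0 * 0 + b * t2 + c) with (b * t2 + c) in H by ring.
replace (al * 0 + s * b * t1 + (s * c + g)) with (g + s * (b * t1 + c)) in H by ring.
replace (al * 0 + s * b * t2 + (s * c + g)) with (g + s * (b * t2 + c)) in H by ring.
exact H.
Qed.

Lemma line_pullback_arc (e b c al s g : R) (side : R * R -> Prop) (t1 t2 : R) : b * al <> 0 ->
  (forall z, 0 < al * fst z -> side z) ->
  arc (Se e) (fun p => g + s * fst p < snd p)
    (b * t1 + c, g + s * (b * t1 + c)) (b * t2 + c, g + s * (b * t2 + c)) ->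
  arc (line_pullback e b c al s g) side (0, t1) (0, t2).
Proof.
intros Hb Hside H.
apply (arc_pullback (Se e) _ _ _ _ _ _ (fun p => g + s * fst p < snd p)); [lra| |].
- intros z; simpl; intros Hz; apply Hside; lra.
- simpl.
  replace (0 * 0 + b * t1 + c) with (b * t1 + c) by ring.
  replace (0 * 0 + b * t2 + c) with (b * t2 + c) by ring.
  replace (al * 0 + s * b * t1 + (s * c + g)) with (g + s * (b * t1 + c)) by ring.
  replace (al * 0 + s * b * t2 + (s * c + g)) with (g + s * (b * t2 + c)) by ring.
  exact H.
Qed.

(** * S4 together with S3 or S4 *)

(** The difference of the first integral at two points of the line, cleared of denominators. *)
Definition line_gap (e b c s g t t' : R) : R :=
  numer e (b * t + c) (g + s * (b * t + c)) * weight e (b * t' + c) ^ 3 -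
  numer e (b * t' + c) (g + s * (b * t' + c)) * weight e (b * t + c) ^ 3.

Lemma line_gap_rational (D A B : R -> R) (e b c s g : R) : polynomial D ->
  rational_over D A -> rational_over D B ->
  rational_over D (fun m => line_gap e b c s g (A m) (B m)).
Proof.
intros HD HA HB.
assert (Hc : forall k : R, rational_over D (fun _ => k))
  by (intros k; apply rational_polynomial, polynomial_const).
assert (X : forall P : R -> R, rational_over D P -> rational_over D (fun m => b * P m + c)).
{ intros P HP; apply (rational_plus D (fun m => b * P m)); auto.
  now apply (rational_mult D (fun _ => b)). }
assert (N : forall P : R -> R, rational_over D P ->
  rational_over D (fun m => numer e (b * P m + c) (g + s * (b * P m + c)))).
{ intros P HP; unfold numer, Rdiv; specialize (X P HP).
  apply rational_minus; [exact HD|apply rational_plus; [exact HD| |apply Hc]|].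
  - apply rational_pow; [exact HD|]; apply rational_plus; [exact HD|apply Hc|].
    apply rational_mult; [exact HD|apply Hc|exact X].
  - apply rational_mult; [exact HD|now apply rational_pow|apply Hc]. }
assert (W : forall P : R -> R, rational_over D P ->
  rational_over D (fun m => weight e (b * P m + c) ^ 3)).
{ intros P HP; specialize (X P HP); apply rational_pow; [exact HD|]; unfold weight.
  apply rational_minus; [exact HD|apply Hc|apply rational_mult; [exact HD|apply Hc|]].
  now apply rational_pow. }
unfold line_gap; apply rational_minus; [exact HD| |]; apply rational_mult; auto.
Qed.

(** The product conditions say that [x] lies between the images of [ta] and [tb] in whichever order
    these come. The sign of [sg * (b * (tb - ta))] matches that order with the direction of travel
    in [Se_graph_arc]. *)
Lemma lower_side (e b c s g sg ta tb : R) : e = 1 \/ e = -1 -> sg = 1 \/ sg = -1 ->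
  0 < sg * (b * (tb - ta)) ->
  (forall x, (x - (b * ta + c)) * ((b * tb + c) - x) >= 0 -> 0 < sg * weight e x) ->
  (forall x, (x - (b * ta + c)) * ((b * tb + c) - x) >= 0 -> 0 < g + s * x) ->
  (forall u v, (u - (b * ta + c)) * ((b * tb + c) - u) >= 0 ->
     (v - (b * ta + c)) * ((b * tb + c) - v) >= 0 -> u < v ->
     0 <= sg * slope_num e g s u -> 0 < sg * slope_num e g s v) ->
  line_gap e b c s g ta tb = 0 ->
  arc (line_pullback e b c (-1) s g) left_half (0, tb) (0, ta) /\
  0 < fst (line_pullback e b c (-1) s g (0, ta)) /\
  fst (line_pullback e b c (-1) s g (0, tb)) < 0.
Proof.
intros He Hsg Hab HW Hl HK Hgap.
assert (Hb : b <> 0) by (intros E; rewrite E, Rmult_0_l, Rmult_0_r in Hab; lra).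
rewrite !line_pullback_speed by auto.
set (xa := b * ta + c) in *; set (xb := b * tb + c) in *.
assert (Hx : 0 < sg * (xb - xa)).
{ unfold xa, xb; replace (b * tb + c - (b * ta + c)) with (b * (tb - ta)) by ring; exact Hab. }
unfold line_gap in Hgap; fold xa xb in Hgap.
assert (Hside : forall z : R * R, 0 < -1 * fst z -> left_half z)
  by (intros z Hz; unfold left_half; lra).
destruct Hsg as [-> | ->].
- assert (Hbt : forall x, xa <= x <= xb -> (x - xa) * (xb - x) >= 0)
    by (intros x Hxx; apply Rle_ge, Rmult_le_pos; lra).
  destruct (Se_graph_arc e g s 1 xa xb He (or_introl eq_refl)) as [S [A _]]; auto; try lra.
  + intros u v Hu Huv Hv; apply HK; auto; apply Hbt; lra.
  + split; [|lra]; apply line_pullback_arc; auto; lra.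
- assert (Hbt : forall x, xb <= x <= xa -> (x - xa) * (xb - x) >= 0).
  { intros x Hxx; replace ((x - xa) * (xb - x)) with ((xa - x) * (x - xb)) by ring.
    apply Rle_ge, Rmult_le_pos; lra. }
  destruct (Se_graph_arc e g s (-1) xb xa He (or_intror eq_refl)) as [S [_ A]]; auto; try lra.
  + intros u v Hu Huv Hv; apply HK; auto; apply Hbt; lra.
  + split; [|lra]; apply line_pullback_arc; auto; lra.
Qed.

(* S4 above the line [y = 2 / (3 sqrt 3)], the one through the end of the period annulus: with
   [x = t / sqrt 3] the first integral on it is proportional to [t^2 / (1 + t^2)^3]. *)
Definition annulus_field : vfield :=
  line_pullback (-1) (/ sqrt 3) 0 1 0 (2 / 3 * / sqrt 3).

Lemma inv_sqrt3 : 0 < / sqrt 3 /\ / sqrt 3 * / sqrt 3 = 1 / 3.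
Proof.
assert (P : 0 < sqrt 3) by (apply sqrt_lt_R0; lra).
assert (E : sqrt 3 * sqrt 3 = 3) by (apply sqrt_sqrt; lra).
split; [now apply Rinv_0_lt_compat|]; rewrite <- Rinv_mult, E; field.
Qed.

Lemma annulus_numer (t : R) :
  numer (-1) (/ sqrt 3 * t + 0) (2 / 3 * / sqrt 3 + 0 * (/ sqrt 3 * t + 0)) = - t ^ 2 / 9.
Proof.
destruct inv_sqrt3 as [_ E]; set (r := / sqrt 3) in *; unfold numer.
replace ((2 / 3 * r + 0 * (r * t + 0)) ^ 2) with (4 / 9 * (r * r)) by field.
replace ((r * t + 0) ^ 2) with (r * r * t ^ 2) by ring; rewrite E; field.
Qed.

Lemma annulus_weight (t : R) : weight (-1) (/ sqrt 3 * t + 0) = 1 + t ^ 2.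
Proof.
destruct inv_sqrt3 as [_ E]; unfold weight.
replace ((/ sqrt 3 * t + 0) ^ 2) with (/ sqrt 3 * / sqrt 3 * t ^ 2) by ring.
rewrite E; field.
Qed.

Lemma annulus_relation (side : R * R -> Prop) (t1 t2 : R) :
  arc annulus_field side (0, t1) (0, t2) ->
  t1 ^ 2 * (1 + t2 ^ 2) ^ 3 = t2 ^ 2 * (1 + t1 ^ 2) ^ 3.
Proof.
intros H; destruct inv_sqrt3 as [P _].
apply line_pullback_relation in H; [|now right|lra].
rewrite !annulus_numer, !annulus_weight in H; lra.
Qed.

Lemma annulus_arc (t1 t2 : R) : 0 < t2 -> t2 < t1 ->
  t1 ^ 2 * (1 + t2 ^ 2) ^ 3 = t2 ^ 2 * (1 + t1 ^ 2) ^ 3 ->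
  arc annulus_field right_half (0, t1) (0, t2) /\
  0 < fst (annulus_field (0, t1)) /\ fst (annulus_field (0, t2)) < 0.
Proof.
intros H2 H12 Hrel; destruct inv_sqrt3 as [P E]; unfold annulus_field.
set (r := / sqrt 3) in *.
(* The height of the line cancels the constant of [numer], which leaves an odd cubic with a single
   sign change on [x > 0]. *)
assert (K : forall x, slope_num (-1) (2 / 3 * r) 0 x = x * (4 * x ^ 2 - 2 / 3)).
{ intros x; unfold slope_num, numer, weight.
  replace ((2 / 3 * r + 0 * x) ^ 2) with (4 / 9 * (r * r)) by field; rewrite E; field. }
rewrite !line_pullback_speed by (auto; lra).
assert (Hlev : numer (-1) (r * t2 + 0) (2 / 3 * r + 0 * (r * t2 + 0)) * weight (-1) (r * t1 + 0) ^ 3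
  = numer (-1) (r * t1 + 0) (2 / 3 * r + 0 * (r * t1 + 0)) * weight (-1) (r * t2 + 0) ^ 3)
  by (unfold r; rewrite !annulus_numer, !annulus_weight; lra).
assert (Q2 : 0 < r * t2) by now apply Rmult_lt_0_compat.
assert (Q1 : r * t2 < r * t1) by now apply Rmult_lt_compat_l.
destruct (Se_graph_arc (-1) (2 / 3 * r) 0 1 (r * t2 + 0) (r * t1 + 0)) as [S [A _]]; auto; try lra.
- intros x Hx; unfold weight; assert (X := pow2_ge_0 x); lra.
- intros x Hx; lra.
- intros u v Hu Huv Hv; rewrite !K; intros Hk.
  assert (U : 0 < u) by lra.
  assert (Uk : 2 / 3 <= 4 * u ^ 2).
  { destruct (Rle_lt_dec (2 / 3) (4 * u ^ 2)) as [L|L]; [exact L|].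
    assert (0 < u * (2 / 3 - 4 * u ^ 2)) by (apply Rmult_lt_0_compat; lra); lra. }
  rewrite Rmult_1_l; apply Rmult_lt_0_compat; [lra|].
  assert (u ^ 2 < v ^ 2) by (simpl; rewrite !Rmult_1_r; apply Rmult_le_0_lt_compat; lra).
  lra.
- split; [|lra]; apply line_pullback_arc; auto; [lra|].
  intros z Hz; unfold right_half; lra.
Qed.

(* Rational parametrisation of the pairs with equal [t^2 / (1 + t^2)^3]: they are
   [q^2 / p] and [p^2 / q] on the circle [p^2 + q^2 = 1], [p = 2 m / (1 + m^2)]. *)
Definition annulus_den (m : R) : R := 2 * m * (1 + m ^ 2) * (1 - m ^ 2).
Definition annulus_big (m : R) : R := (1 - m ^ 2) ^ 3 / annulus_den m.
Definition annulus_small (m : R) : R := 8 * m ^ 3 / annulus_den m.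

Lemma annulus_den_pos (m : R) : 0 < m < 1 -> 0 < annulus_den m.
Proof.
intros Hm; unfold annulus_den; assert (m ^ 2 < 1) by (simpl; nra).
assert (0 < 1 + m ^ 2) by (simpl; nra).
repeat apply Rmult_lt_0_compat; lra.
Qed.

Lemma half_angle (p q : R) : 0 < p -> 0 < q -> p ^ 2 + q ^ 2 = 1 ->
  exists m, 0 < m < 1 /\ p * (1 + m ^ 2) = 2 * m /\ q * (1 + m ^ 2) = 1 - m ^ 2.
Proof.
intros Hp Hq E; exists (p / (1 + q)).
assert (P : p < 1) by nra.
split; [split|split].
- apply Rdiv_lt_0_compat; lra.
- apply (Rmult_lt_reg_r (1 + q)); [lra|]; unfold Rdiv; rewrite Rmult_assoc, Rinv_l; lra.
- field_simplify_eq; [|lra]; replace (p ^ 3) with (p * p ^ 2) by ring.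
  replace (p ^ 2) with (1 - q ^ 2) by lra; ring.
- field_simplify_eq; [|lra]; replace (p ^ 2) with (1 - q ^ 2) by lra; ring.
Qed.

(** Without the diagonal factor [a - b], the relation between the squares is
    [a * b * (a + b + 3) = 1]. With [p ^ 2] and [q ^ 2] proportional to [1 + b] and [1 + a] it says
    [a * p ^ 2 = q ^ 4], so square roots can be taken. *)
Lemma annulus_parameter (t1 t2 : R) : 0 < t1 -> 0 < t2 -> t1 <> t2 ->
  t1 ^ 2 * (1 + t2 ^ 2) ^ 3 = t2 ^ 2 * (1 + t1 ^ 2) ^ 3 ->
  exists m, 0 < m < 1 /\ t1 = annulus_big m /\ t2 = annulus_small m.
Proof.
intros H1 H2 Hne Hrel.
set (a := t1 ^ 2); set (b := t2 ^ 2).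
assert (Pa : 0 < a) by now apply pow_lt. assert (Pb : 0 < b) by now apply pow_lt.
assert (Nab : a - b <> 0).
{ unfold a, b; replace (t1 ^ 2 - t2 ^ 2) with ((t1 - t2) * (t1 + t2)) by ring.
  apply Rmult_integral_contrapositive_currified; lra. }
assert (E : a * b * (a + b + 3) = 1).
{ apply (Rmult_eq_reg_l (a - b)); [|exact Nab].
  fold a b in Hrel; ring_simplify in Hrel; ring_simplify; lra. }
assert (Pd : 0 < 2 + a + b) by lra.
set (p := sqrt ((1 + b) / (2 + a + b))); set (q := sqrt ((1 + a) / (2 + a + b))).
assert (Hp : 0 < p) by (apply sqrt_lt_R0, Rdiv_lt_0_compat; lra).
assert (Hq : 0 < q) by (apply sqrt_lt_R0, Rdiv_lt_0_compat; lra).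
assert (Ep : p ^ 2 = (1 + b) / (2 + a + b))
  by (apply pow2_sqrt, Rlt_le, Rdiv_lt_0_compat; lra).
assert (Eq : q ^ 2 = (1 + a) / (2 + a + b))
  by (apply pow2_sqrt, Rlt_le, Rdiv_lt_0_compat; lra).
destruct (half_angle p q Hp Hq) as [m [Hm [Mp Mq]]].
{ rewrite Ep, Eq; field; lra. }
assert (T1 : t1 * p = q ^ 2).
{ apply Rsqr_inj; [apply Rlt_le, Rmult_lt_0_compat; lra|apply pow2_ge_0|].
  unfold Rsqr; replace (t1 * p * (t1 * p)) with (a * p ^ 2) by (unfold a; ring).
  rewrite Ep, Eq; field_simplify_eq; [|lra]; ring_simplify; ring_simplify in E; lra. }
assert (T2 : t2 * q = p ^ 2).
{ apply Rsqr_inj; [apply Rlt_le, Rmult_lt_0_compat; lra|apply pow2_ge_0|].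
  unfold Rsqr; replace (t2 * q * (t2 * q)) with (b * q ^ 2) by (unfold b; ring).
  rewrite Ep, Eq; field_simplify_eq; [|lra]; ring_simplify; ring_simplify in E; lra. }
assert (D := annulus_den_pos m Hm).
assert (Pm : 0 < 1 + m ^ 2) by (assert (X := pow2_ge_0 m); lra).
exists m; split; [exact Hm|split].
- unfold annulus_big; apply (Rmult_eq_reg_r (annulus_den m)); [|lra].
  replace ((1 - m ^ 2) ^ 3 / annulus_den m * annulus_den m) with ((1 - m ^ 2) ^ 3) by (field; lra).
  unfold annulus_den; rewrite <- Mp, <- Mq.
  transitivity (t1 * p * q * (1 + m ^ 2) ^ 3); [ring|rewrite T1; ring].
- unfold annulus_small; apply (Rmult_eq_reg_r (annulus_den m)); [|lra].
  replace (8 * m ^ 3 / annulus_den m * annulus_den m) with ((2 * m) ^ 3) by (field; lra).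
  unfold annulus_den; rewrite <- Mp, <- Mq.
  transitivity (t2 * q * p * (1 + m ^ 2) ^ 3); [ring|rewrite T2; ring].
Qed.

Lemma annulus_pair (m : R) : 0 < m < 1 ->
  annulus_big m ^ 2 * (1 + annulus_small m ^ 2) ^ 3 =
  annulus_small m ^ 2 * (1 + annulus_big m ^ 2) ^ 3.
Proof.
intros Hm; assert (m ^ 2 < 1) by (simpl; nra).
assert (0 < 1 + m ^ 2) by (simpl; nra).
unfold annulus_big, annulus_small, annulus_den; field; lra.
Qed.

Lemma cube_lt (a b : R) : 0 < a -> a < b -> a ^ 3 < b ^ 3.
Proof.
intros Ha Hab; assert (0 < (b - a) * (b ^ 2 + a * b + a ^ 2)); [|lra].
assert (0 < a * b) by (apply Rmult_lt_0_compat; lra).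
apply Rmult_lt_0_compat; [lra|]; assert (A := pow2_ge_0 a); assert (B := pow2_ge_0 b); lra.
Qed.

(** The two points meet when [2 * m = 1 - m ^ 2], at the tangent of an eighth of [PI], which is
    [sqrt 2 - 1]; [2 / 5] is a rational just below it. *)
Lemma annulus_order (m : R) : 0 < m -> m <= 2 / 5 -> 0 < annulus_small m < annulus_big m.
Proof.
intros H0 H1; assert (D := annulus_den_pos m ltac:(lra)).
unfold annulus_small, annulus_big; split.
- apply Rdiv_lt_0_compat; [|exact D]; assert (0 < m ^ 3) by now apply pow_lt. lra.
- apply Rmult_lt_compat_r; [now apply Rinv_0_lt_compat|].
  replace (8 * m ^ 3) with ((2 * m) ^ 3) by ring.
  apply cube_lt; [lra|]; assert (m * m <= 2 / 5 * (2 / 5)) by (apply Rmult_le_compat; lra).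
  simpl; lra.
Qed.

Lemma annulus_big_decreasing (m m' : R) : 0 < m -> m < m' -> m' < 1 ->
  annulus_big m' < annulus_big m.
Proof.
intros H0 H1 H2.
assert (S : m ^ 2 < m' ^ 2) by (simpl; nra).
assert (S' : m' ^ 2 < 1) by (simpl; nra).
assert (S0 : 0 < m ^ 2) by now apply pow_lt.
assert (E : forall n, 0 < n < 1 -> annulus_big n = (1 - n ^ 2) ^ 2 / (2 * n * (1 + n ^ 2))).
{ intros n Hn; unfold annulus_big, annulus_den; assert (n ^ 2 < 1) by (simpl; nra).
  assert (0 < n ^ 2) by now apply pow_lt. field; lra. }
rewrite !E by lra; apply (Rle_lt_trans _ ((1 - m ^ 2) ^ 2 / (2 * m' * (1 + m' ^ 2)))).
- apply Rmult_le_compat_r.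
  + apply Rlt_le, Rinv_0_lt_compat, Rmult_lt_0_compat; lra.
  + apply pow_incr; lra.
- apply Rmult_lt_compat_l; [apply pow_lt; lra|]; apply Rinv_lt_contravar.
  + repeat apply Rmult_lt_0_compat; lra.
  + apply Rmult_gt_0_lt_compat; lra.
Qed.

(** The condition [0 <= b * (x - c)] describes the half-line [t >= 0], which contains the segment
    between any two admissible ends. The sign conditions can thus be checked once, independently of
    the parameter. *)
Lemma annulus_lower (e b c s g sg ta tb : R) : e = 1 \/ e = -1 -> sg = 1 \/ sg = -1 ->
  sg * b < 0 -> 0 < tb < ta ->
  (forall x, 0 <= b * (x - c) -> 0 < sg * weight e x) ->
  (forall x, 0 <= b * (x - c) -> 0 < g + s * x) ->
  (forall u v, 0 <= b * (u - c) -> 0 <= b * (v - c) -> u < v ->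
     0 <= sg * slope_num e g s u -> 0 < sg * slope_num e g s v) ->
  line_gap e b c s g ta tb = 0 ->
  arc (line_pullback e b c (-1) s g) left_half (0, tb) (0, ta) /\
  0 < fst (line_pullback e b c (-1) s g (0, ta)) /\
  fst (line_pullback e b c (-1) s g (0, tb)) < 0.
Proof.
intros He Hsg Hb Ht HW Hl HK Hgap.
assert (Hin : forall x, (x - (b * ta + c)) * (b * tb + c - x) >= 0 -> 0 <= b * (x - c)).
{ intros x Hx; destruct (Rle_lt_dec 0 (b * (x - c))) as [P|P]; [exact P|exfalso].
  set (y := b * (x - c)) in *.
  assert (Hbb : 0 < b * b) by (assert (b <> 0) by nra; nra).
  assert (A : 0 <= (y - b * b * ta) * (b * b * tb - y)).
  { replace ((y - b * b * ta) * (b * b * tb - y)) with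
      (b * b * ((x - (b * ta + c)) * (b * tb + c - x))) by (unfold y; ring).
    apply Rmult_le_pos; lra. }
  assert (0 < b * b * ta) by (apply Rmult_lt_0_compat; lra).
  assert (0 < b * b * tb) by (apply Rmult_lt_0_compat; lra).
  assert (0 < (b * b * ta - y) * (b * b * tb - y)) by (apply Rmult_lt_0_compat; lra).
  lra. }
apply (lower_side e b c s g sg); auto.
- replace (sg * (b * (tb - ta))) with ((- (sg * b)) * (ta - tb)) by ring.
  apply Rmult_lt_0_compat; lra.
- intros u v Hu Hv; apply HK; auto.
Qed.

Lemma annulus_three_cycles (e b c s g sg m0 m1 m2 m3 : R) :
  e = 1 \/ e = -1 -> sg = 1 \/ sg = -1 -> sg * b < 0 ->
  (forall x, 0 <= b * (x - c) -> 0 < sg * weight e x) ->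
  (forall x, 0 <= b * (x - c) -> 0 < g + s * x) ->
  (forall u v, 0 <= b * (u - c) -> 0 <= b * (v - c) -> u < v ->
     0 <= sg * slope_num e g s u -> 0 < sg * slope_num e g s v) ->
  0 < m0 -> m0 < m1 -> m1 < m2 -> m2 < m3 -> m3 <= 2 / 5 ->
  let gap m := line_gap e b c s g (annulus_big m) (annulus_small m) in
  gap m0 * gap m1 < 0 -> gap m1 * gap m2 < 0 -> gap m2 * gap m3 < 0 ->
  has_three_crossing_limit_cycles annulus_field (line_pullback e b c (-1) s g).
Proof.
intros He Hsg Hb HW Hl HK H0 H01 H12 H23 H3 gap G0 G1 G2.
assert (PD : polynomial annulus_den).
{ unfold annulus_den.
  polynomial_tac. }
assert (PG : rational_over annulus_den gap).
{ apply line_gap_rational; [exact PD| |]; apply rational_quotient;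
  polynomial_tac. }
assert (HD : forall m, m0 <= m <= m3 -> 0 < annulus_den m)
  by (intros m Hm; apply annulus_den_pos; lra).
assert (Hb0 : b <> 0) by (intros E; rewrite E, Rmult_0_r in Hb; lra).
(* The parametrisation reaches all positive pairs, hence the lower bound 0. Since [annulus_big]
   decreases, its value at [m0] bounds all the ends. *)
apply (three_limit_cycles _ _ 0 (annulus_big m0 + 1) (fun m => 0 < m < 1)
  annulus_big annulus_small gap m0 m1 m2 m3); try lra.
- apply line_pullback_lipschitz.
- apply line_pullback_lipschitz.
- destruct (rational_roots_finite annulus_den gap m0 PG) as [L HL].
  + assert (X := HD m0 ltac:(lra)); lra.
  + intros E; rewrite E in G0; lra.
  + exists L; intros m Hm; apply HL; assert (X := annulus_den_pos m Hm); lra.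
- intros y1 y2 B1 B2 Hne A1 A2.
  destruct (annulus_parameter y1 y2) as [m [Hm [E1 E2]]]; try lra.
  + now apply (annulus_relation right_half).
  (* The first alternative always applies: pairs in the reverse order have their parameter beyond
     [sqrt 2 - 1], still inside the domain. *)
  + exists m; split; [exact Hm|split; [|now left]].
    apply line_pullback_relation in A2; [|exact He|lra].
    rewrite E1, E2 in A2; unfold gap, line_gap; lra.
- intros m Hm; destruct (annulus_order m ltac:(lra) ltac:(lra)) as [O1 O2].
  assert (X := annulus_big_decreasing m0 m ltac:(lra) ltac:(lra) ltac:(lra)); lra.
- intros m Hm Z; destruct (annulus_order m ltac:(lra) ltac:(lra)) as [O1 O2].
  split; [apply annulus_arc; auto; apply annulus_pair; lra|].
  now apply (annulus_lower e b c s g sg).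
- intros m Hm Z; destruct (annulus_order m ltac:(lra) ltac:(lra)) as [O1 O2].
  destruct (annulus_arc (annulus_big m) (annulus_small m)) as [_ [X1 X2]]; auto.
  { apply annulus_pair; lra. }
  destruct (annulus_lower e b c s g sg (annulus_big m) (annulus_small m)) as [_ [X3 X4]]; auto.
- intros m m' K1 K2 K3 E.
  assert (X := annulus_big_decreasing m m' ltac:(lra) ltac:(lra) ltac:(lra)); lra.
- apply (rational_zero_between annulus_den); auto; intros m Hm; apply HD; lra.
- apply (rational_zero_between annulus_den); auto; intros m Hm; apply HD; lra.
- apply (rational_zero_between annulus_den); auto; intros m Hm; apply HD; lra.
Qed.

Lemma example_S3_S4 : exists_example S3 S4.
Proof.
(* For [t >= 0] this line stays in [x >= 2], where the weight of [S3] is negative; hence the sign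
   [-1] below. The gap alternates in sign at the four sample parameters. *)
exists annulus_field, (line_pullback 1 (3 / 5) 2 (-1) (1 / 20) (99 / 100)).
split.
{ right; rewrite S3_Se, S4_Se; destruct inv_sqrt3 as [P _].
  split; apply line_pullback_in_class; lra. }
apply (annulus_three_cycles _ _ _ _ _ (-1) (1 / 50) (1 / 20) (1 / 5) (1 / 3)); auto; try lra.
- intros x Hx; unfold weight; assert (2 <= x) by lra.
  assert (2 * 2 <= x * x) by (apply Rmult_le_compat; lra); simpl; lra.
- intros x Hx; lra.
- intros u v Hu Hv Huv; assert (2 <= u) by lra.
  assert (E : forall x, slope_num 1 (99 / 100) (1 / 20) x =
    99 / 1000 + 49117 / 2500 * x + 297 / 200 * x ^ 2 - 397 / 100 * x ^ 3)
    by (intros x; unfold slope_num, numer, weight; field).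
  rewrite !E; intros Hk.
  (* The product is the difference of the cubic at [u] and at [v], so the cubic is strictly
     decreasing on [x >= 2]. *)
  assert (0 < (v - u) * (397 / 100 * (v ^ 2 + u * v + u ^ 2) - 297 / 200 * (u + v) - 49117 / 2500)).
  { apply Rmult_lt_0_compat; [lra|]; nra. }
  nra.
- unfold line_gap, annulus_big, annulus_small, annulus_den, numer, weight; lra.
- unfold line_gap, annulus_big, annulus_small, annulus_den, numer, weight; lra.
- unfold line_gap, annulus_big, annulus_small, annulus_den, numer, weight; lra.
Qed.

Lemma example_S4_S4 : exists_example S4 S4.
Proof.
(* For [t >= 0] this line runs in [x <= -2], at positive height and with increasing [slope_num]. The
   weight of [S4] is positive everywhere, so the sign is [1]. *)
exists annulus_field, (line_pullback (-1) (- (3 / 4)) (-2) (-1) (- (335 / 1000)) (548 / 1000)).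
split.
{ right; rewrite S4_Se; destruct inv_sqrt3 as [P _].
  split; apply line_pullback_in_class; lra. }
apply (annulus_three_cycles _ _ _ _ _ 1 (1 / 20) (1 / 12) (1 / 5) (1 / 3)); auto; try lra.
- intros x Hx; unfold weight; assert (X := pow2_ge_0 x); lra.
- intros x Hx; lra.
- intros u v Hu Hv Huv; assert (v <= -2) by lra.
  assert (E : forall x, slope_num (-1) (548 / 1000) (- (335 / 1000)) x =
    - 9179 / 25000 - 1590511 / 500000 * x + 27537 / 5000 * x ^ 2 + 26533 / 10000 * x ^ 3)
    by (intros x; unfold slope_num, numer, weight; field).
  rewrite !E; intros Hk.
  assert (0 < (v - u) * (26533 / 10000 * (v ^ 2 + u * v + u ^ 2) + 27537 / 5000 * (u + v)
    - 1590511 / 500000)).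
  { apply Rmult_lt_0_compat; [lra|]; nra. }
  nra.
- unfold line_gap, annulus_big, annulus_small, annulus_den, numer, weight; lra.
- unfold line_gap, annulus_big, annulus_small, annulus_den, numer, weight; lra.
- unfold line_gap, annulus_big, annulus_small, annulus_den, numer, weight; lra.
Qed.

(** * Two fields of class S3 *)

(* S3 above the axis [y = 0], around its centre [x = 1 / sqrt 2]. *)
Definition axis_field : vfield := line_pullback 1 1 0 1 0 0.

(** The opposite of [weight 1], positive outside the strip between the two invariant lines; the
    centre [x = 1 / sqrt 2] has the value [1 / 2]. *)
Definition outer_weight (x : R) : R := 3 * x ^ 2 - 1.

(** The first-integral relation on the axis, [(1 - 3 * v1) * v2 ^ 3 = (1 - 3 * v2) * v1 ^ 3],
    divided by [v1 - v2]. *)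
Definition axis_pair (x1 x2 : R) : Prop :=
  let v1 := outer_weight x1 in let v2 := outer_weight x2 in
  3 * (v1 * v2 * (v1 + v2)) = v1 ^ 2 + v1 * v2 + v2 ^ 2.

Lemma axis_relation (side : R * R -> Prop) (t1 t2 : R) :
  0 < t1 -> 0 < t2 -> t1 <> t2 -> arc axis_field side (0, t1) (0, t2) -> axis_pair t1 t2.
Proof.
intros H1 H2 Hne H.
apply line_pullback_relation in H; [|now left|lra].
assert (N : forall t, numer 1 (1 * t + 0) (0 + 0 * (1 * t + 0)) = (1 - 3 * outer_weight t) / 27)
  by (intros t; unfold numer, outer_weight; field).
assert (W : forall t, weight 1 (1 * t + 0) = - outer_weight t)
  by (intros t; unfold weight, outer_weight; ring).
rewrite !N, !W in H; unfold axis_pair; cbv zeta.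
assert (Nz : outer_weight t1 - outer_weight t2 <> 0).
{ unfold outer_weight; replace (3 * t1 ^ 2 - 1 - (3 * t2 ^ 2 - 1)) with
    (3 * (t1 + t2) * (t1 - t2)) by ring.
  apply Rmult_integral_contrapositive_currified; lra. }
set (v1 := outer_weight t1) in *; set (v2 := outer_weight t2) in *.
apply (Rmult_eq_reg_l (v1 - v2)); [|exact Nz]; lra.
Qed.

(** [Se_graph_arc] requires positive height. Here the ends have [y = 0], where [x' = 0] and the
    orbit has vertical tangents as a graph over [x]. The angle [s] with [x = mid - rad * cos s]
    resolves this, because [(x - x1) * (x2 - x)] becomes the square of [rad * sin s]. *)
Lemma axis_arc (x1 x2 : R) : 0 < x1 -> x1 < x2 -> 0 < outer_weight x1 -> axis_pair x1 x2 ->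
  arc axis_field right_half (0, x1) (0, x2) /\
  0 < fst (axis_field (0, x1)) /\ fst (axis_field (0, x2)) < 0.
Proof.
intros H1 H12 Hv1 Hrel; unfold axis_pair in Hrel; cbv zeta in Hrel.
assert (Hmono : forall x y, 0 < x -> x <= y -> outer_weight x <= outer_weight y).
{ intros x y Hx Hxy; unfold outer_weight.
  assert (x * x <= y * y) by (apply Rmult_le_compat; lra); simpl; lra. }
assert (Hv12 : outer_weight x1 < outer_weight x2).
{ unfold outer_weight; assert (0 < (x2 - x1) * (x2 + x1)) by (apply Rmult_lt_0_compat; lra).
  simpl; lra. }
unfold axis_field; rewrite !line_pullback_speed by (auto; lra).
assert (K : forall x, slope_num 1 0 0 (1 * x + 0) = x * (1 - 2 * outer_weight x) * (2 / 3)).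
{ intros x; unfold slope_num, numer, weight, outer_weight; field. }
rewrite !K.
set (v1 := outer_weight x1) in *; set (v2 := outer_weight x2) in *.
assert (Hc : v1 < 1 / 2 < v2).
{ split.
  - destruct (Rlt_le_dec v1 (1 / 2)) as [L|L]; [exact L|exfalso].
    assert (A : 1 / 2 * (v2 * (v1 + v2)) <= v1 * (v2 * (v1 + v2))).
    { apply Rmult_le_compat_r; [apply Rmult_le_pos; lra|exact L]. }
    assert (v1 * v1 < v2 * v2) by (apply Rmult_le_0_lt_compat; lra).
    assert (v1 * v1 < v1 * v2) by (apply Rmult_lt_compat_l; lra). nra.
  - destruct (Rlt_le_dec (1 / 2) v2) as [L|L]; [exact L|exfalso].
    assert (A : v2 * (v1 * (v1 + v2)) <= 1 / 2 * (v1 * (v1 + v2))).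
    { apply Rmult_le_compat_r; [apply Rmult_le_pos; lra|exact L]. }
    assert (v1 * v1 < v2 * v2) by (apply Rmult_le_0_lt_compat; lra).
    assert (v1 * v2 < v2 * v2) by (apply Rmult_lt_compat_r; lra). nra. }
split; [|split].
2: { assert (0 < x1 * (1 - 2 * v1)) by (apply Rmult_lt_0_compat; lra); lra. }
2: { assert (0 < x2 * (2 * v2 - 1)) by (apply Rmult_lt_0_compat; lra); lra. }
set (sigma := v1 ^ 2 + v1 * v2 + v2 ^ 2) in *.
assert (Ps : 0 < sigma).
{ unfold sigma; assert (0 < v1 ^ 2) by (apply pow_lt; lra).
  assert (0 < v2 ^ 2) by (apply pow_lt; lra).
  assert (0 < v1 * v2) by (apply Rmult_lt_0_compat; lra); lra. }
(* In [v = outer_weight x] the level curve reads [y ^ 2 = - kap * v ^ 3 + v / 9 - 1 / 27]. There is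
   no quadratic term, so the third root is [- (v1 + v2)]; [E1] and [E2] compare the remaining
   coefficients. *)
set (kap := / (9 * sigma)).
assert (Pk : 0 < kap) by (apply Rinv_0_lt_compat; lra).
assert (E1 : kap * sigma = 1 / 9) by (unfold kap; field; lra).
assert (E2 : kap * (v1 * v2 * (v1 + v2)) = 1 / 27).
{ replace (v1 * v2 * (v1 + v2)) with (sigma / 3) by lra; lra. }
set (mid := (x1 + x2) / 2); set (rad := (x2 - x1) / 2).
assert (Pr : 0 < rad) by (unfold rad; lra).
(* [y^2 = G(x) (x - x1) (x2 - x)] on the orbit *)
set (G := fun x => 9 * kap * ((x + x1) * (x + x2) * (outer_weight x + v1 + v2))).
set (dG := fun x => 9 * kap * ((x + x1 + (x + x2)) * (outer_weight x + v1 + v2)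
   + (x + x1) * (x + x2) * (6 * x))).
set (X := fun s => mid - rad * cos s).
assert (HX : forall s, x1 <= X s <= x2).
{ intros s; assert (C := COS_bound s); unfold X.
  assert (rad * cos s <= rad * 1) by (apply Rmult_le_compat_l; lra).
  assert (rad * (-1) <= rad * cos s) by (apply Rmult_le_compat_l; lra).
  unfold mid, rad in *; lra. }
assert (HG : forall s, 0 < G (X s)).
{ intros s; destruct (HX s) as [A B]; assert (V := Hmono x1 (X s) H1 A).
  unfold G; repeat apply Rmult_lt_0_compat; try lra.
  fold v1 in V; lra. }
assert (HV : forall s, 0 < outer_weight (X s)).
{ intros s; destruct (HX s) as [A B]; assert (V := Hmono x1 (X s) H1 A); fold v1 in V; lra. }
assert (DX : forall s, is_derive X s (rad * sin s)).
{ intros s; unfold X; auto_derive; [trivial|ring]. }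
assert (DG : forall s, is_derive (fun s => G (X s)) s (dG (X s) * (rad * sin s))).
{ intros s; evar_last; [apply (is_derive_comp G X s (dG (X s)) (rad * sin s)); [|apply DX]|].
  - unfold G, dG, outer_weight; auto_derive; [trivial|ring].
  - unfold scal; simpl; unfold mult; simpl; ring. }
assert (DS : forall s, is_derive (fun s => sqrt (G (X s))) s
  (dG (X s) * (rad * sin s) / (2 * sqrt (G (X s))))).
{ intros s; apply (is_derive_sqrt (fun s => G (X s))); [apply DG|apply HG]. }
set (Y := fun s => rad * sin s * sqrt (G (X s))).
set (dY := fun s => rad * cos s * sqrt (G (X s))
   + rad * sin s * (dG (X s) * (rad * sin s) / (2 * sqrt (G (X s))))).
assert (DY : forall s, is_derive Y s (dY s)).
{ intros s; unfold Y, dY.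
  apply (is_derive_mult (fun s => rad * sin s) (fun s => sqrt (G (X s))) s);
    [auto_derive; [trivial|ring]|apply DS|intros; apply Rmult_comm]. }
set (c := fun s => sqrt (G (X s)) * outer_weight (X s)).
apply line_pullback_arc; [lra|intros z Hz; unfold right_half; lra|].
replace (1 * x1 + 0) with (X 0) by (unfold X; rewrite cos_0; unfold mid, rad; field).
replace (1 * x2 + 0) with (X PI) by (unfold X; rewrite cos_PI; unfold mid, rad; field).
replace (0 + 0 * X 0) with (Y 0) by (unfold Y; rewrite sin_0; ring).
replace (0 + 0 * X PI) with (Y PI) by (unfold Y; rewrite sin_PI; ring).
assert (PP := PI_RGT_0).
apply (arc_along (Se 1) _ X Y (fun s => rad * sin s) dY c (-1) 0 PI (PI + 1)); try lra.
- intros s _; split.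
  + apply continuity_pt_mult.
    * exact (is_derive_continuity_pt _ _ _ (DS s)).
    * apply (continuity_pt_comp X outer_weight).
      -- exact (is_derive_continuity_pt _ _ _ (DX s)).
      -- apply (is_derive_continuity_pt _ _ (6 * X s)); unfold outer_weight.
         auto_derive; [trivial|ring].
  + apply Rmult_lt_0_compat; [apply sqrt_lt_R0, HG|apply HV].
- intros s _; split; [apply DX|apply DY].
- intros s _; unfold Se.
  assert (Q := sqrt_lt_R0 _ (HG s)).
  assert (S2 : sqrt (G (X s)) * sqrt (G (X s)) = G (X s)) by (apply sqrt_sqrt, Rlt_le, HG).
  f_equal; [unfold Y, c, outer_weight; ring|].
  transitivity (outer_weight (X s) * (rad * cos s * G (X s) + (rad * sin s) ^ 2 * dG (X s) / 2)).
  2: { unfold c, dY; rewrite <- S2 at 1; field; lra. }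
  replace (Y s ^ 2) with ((rad * sin s) ^ 2 * G (X s)) by (rewrite <- S2 at 1; unfold Y; ring).
  assert (T1 : rad * cos s = mid - X s) by (unfold X; ring).
  assert (T2 : (rad * sin s) ^ 2 = (X s - x1) * (x2 - X s)).
  { assert (T := sin2_cos2 s); unfold Rsqr in T.
    replace ((rad * sin s) ^ 2) with (rad ^ 2 * (sin s * sin s)) by ring.
    replace (sin s * sin s) with (1 - cos s * cos s) by lra.
    replace (rad ^ 2 * (1 - cos s * cos s)) with (rad ^ 2 - (rad * cos s) ^ 2) by ring.
    rewrite T1; unfold mid, rad; field. }
  rewrite T1, T2; set (x := X s).
  apply Rminus_diag_uniq.
  (* The defect of the equation of motion is a combination of [E1] and [E2]; with these coefficients
     the rest is an identity. *)
  transitivity (6 * x * outer_weight x * (kap * sigma - 1 / 9)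
    - 9 * x * (kap * (v1 * v2 * (v1 + v2)) - 1 / 27)); [|rewrite E1, E2; ring].
  unfold G, dG, sigma, v1, v2, mid, outer_weight; field.
- intros s Hs; simpl.
  assert (0 < Y s); [|lra].
  assert (0 < sin s) by (apply sin_gt_0; lra).
  apply Rmult_lt_0_compat; [now apply Rmult_lt_0_compat|apply sqrt_lt_R0, HG].
Qed.

(* Pairs on the axis are [(1 + q^2) / (3 q)] and [(1 + p^2) / (3 p)] with [p^2 + q^2 = 1]. *)
Definition axis_den (m : R) : R := 6 * m * (1 + m ^ 2) * (1 - m ^ 2).
Definition axis_small (m : R) : R := 4 * m * (1 + m ^ 4) / axis_den m.
Definition axis_big (m : R) : R := (1 + 6 * m ^ 2 + m ^ 4) * (1 - m ^ 2) / axis_den m.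

Lemma axis_den_pos (m : R) : 0 < m < 1 -> 0 < axis_den m.
Proof.
intros Hm; unfold axis_den; assert (m ^ 2 < 1) by (simpl; nra).
assert (0 < 1 + m ^ 2) by (simpl; nra).
repeat apply Rmult_lt_0_compat; lra.
Qed.

(** The curve in [v1], [v2] is cut by rays through the origin. With [p ^ 2] and [q ^ 2] the shares
    of [v1] and [v2] in their sum, the relation becomes [9 * t2 ^ 2 * p ^ 2 = (1 + p ^ 2) ^ 2], and
    likewise for [t1] and [q]. *)
Lemma axis_parameter (t1 t2 : R) : 0 < t1 -> 0 < t2 ->
  0 < outer_weight t1 -> 0 < outer_weight t2 -> axis_pair t1 t2 ->
  exists m, 0 < m < 1 /\ t1 = axis_small m /\ t2 = axis_big m.
Proof.
intros H1 H2 P1 P2 Hrel; unfold axis_pair in Hrel; cbv zeta in Hrel.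
assert (S1 : t1 ^ 2 = (outer_weight t1 + 1) / 3) by (unfold outer_weight; field).
assert (S2 : t2 ^ 2 = (outer_weight t2 + 1) / 3) by (unfold outer_weight; field).
set (v1 := outer_weight t1) in *; set (v2 := outer_weight t2) in *.
set (p := sqrt (v1 / (v1 + v2))); set (q := sqrt (v2 / (v1 + v2))).
assert (Hp : 0 < p) by (apply sqrt_lt_R0, Rdiv_lt_0_compat; lra).
assert (Hq : 0 < q) by (apply sqrt_lt_R0, Rdiv_lt_0_compat; lra).
assert (Ep : p ^ 2 = v1 / (v1 + v2)) by (apply pow2_sqrt, Rlt_le, Rdiv_lt_0_compat; lra).
assert (Eq : q ^ 2 = v2 / (v1 + v2)) by (apply pow2_sqrt, Rlt_le, Rdiv_lt_0_compat; lra).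
destruct (half_angle p q Hp Hq) as [m [Hm [Mp Mq]]].
{ rewrite Ep, Eq; field; lra. }
assert (T2 : t2 * (3 * p) = 1 + p ^ 2).
{ apply Rsqr_inj; [apply Rlt_le, Rmult_lt_0_compat; lra|assert (X := pow2_ge_0 p); lra|].
  unfold Rsqr; replace (t2 * (3 * p) * (t2 * (3 * p))) with (9 * t2 ^ 2 * p ^ 2) by ring.
  rewrite Ep, S2; field_simplify_eq; [|lra]; ring_simplify; ring_simplify in Hrel; lra. }
assert (T1 : t1 * (3 * q) = 1 + q ^ 2).
{ apply Rsqr_inj; [apply Rlt_le, Rmult_lt_0_compat; lra|assert (X := pow2_ge_0 q); lra|].
  unfold Rsqr; replace (t1 * (3 * q) * (t1 * (3 * q))) with (9 * t1 ^ 2 * q ^ 2) by ring.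
  rewrite Eq, S1; field_simplify_eq; [|lra]; ring_simplify; ring_simplify in Hrel; lra. }
assert (D := axis_den_pos m Hm).
exists m; split; [exact Hm|split].
- unfold axis_small; apply (Rmult_eq_reg_r (axis_den m)); [|lra].
  transitivity (4 * m * (1 + m ^ 4)); [|field; lra].
  unfold axis_den.
  transitivity (2 * m * (1 + m ^ 2) * (t1 * 3 * (1 - m ^ 2))); [ring|]; rewrite <- Mq.
  transitivity (2 * m * (1 + m ^ 2) ^ 2 * (t1 * (3 * q))); [ring|]; rewrite T1.
  transitivity (2 * m * ((1 + m ^ 2) ^ 2 + (q * (1 + m ^ 2)) ^ 2)); [ring|]; rewrite Mq; ring.
- unfold axis_big; apply (Rmult_eq_reg_r (axis_den m)); [|lra].
  transitivity ((1 + 6 * m ^ 2 + m ^ 4) * (1 - m ^ 2)); [|field; lra].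
  unfold axis_den.
  transitivity ((1 - m ^ 2) * (1 + m ^ 2) * (t2 * 3 * (2 * m))); [ring|]; rewrite <- Mp.
  transitivity ((1 - m ^ 2) * (1 + m ^ 2) ^ 2 * (t2 * (3 * p))); [ring|]; rewrite T2.
  transitivity ((1 - m ^ 2) * ((1 + m ^ 2) ^ 2 + (p * (1 + m ^ 2)) ^ 2)); [ring|]; rewrite Mp; ring.
Qed.

Lemma axis_pair_param (m : R) : 0 < m < 1 -> axis_pair (axis_small m) (axis_big m).
Proof.
intros Hm; assert (m ^ 2 < 1) by (simpl; nra).
assert (0 < 1 + m ^ 2) by (simpl; nra).
unfold axis_pair, outer_weight, axis_small, axis_big, axis_den; field; lra.
Qed.

Lemma axis_small_value (m : R) : 0 < m < 1 ->
  axis_small m = 2 / 3 * ((1 + m ^ 4) / (1 - m ^ 4)).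
Proof.
intros Hm; assert (m ^ 2 < 1) by (simpl; nra).
assert (0 < 1 + m ^ 2) by (simpl; nra).
unfold axis_small, axis_den; replace (1 - m ^ 4) with ((1 + m ^ 2) * (1 - m ^ 2)) by ring.
field; lra.
Qed.

Lemma axis_small_increasing (m m' : R) : 0 < m -> m < m' -> m' < 1 ->
  axis_small m < axis_small m'.
Proof.
intros H0 H1 H2; rewrite !axis_small_value by lra.
assert (Q : m ^ 2 < m' ^ 2 < 1) by (simpl; nra).
assert (Q0 : 0 < m ^ 2) by now apply pow_lt.
assert (Q4 : m ^ 4 < m' ^ 4 < 1).
{ replace (m ^ 4) with (m ^ 2 * m ^ 2) by ring; replace (m' ^ 4) with (m' ^ 2 * m' ^ 2) by ring.
  nra. }
assert (0 < m ^ 4) by now apply pow_lt.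
apply Rmult_lt_compat_l; [lra|].
replace ((1 + m ^ 4) / (1 - m ^ 4)) with (2 * / (1 - m ^ 4) - 1) by (field; lra).
replace ((1 + m' ^ 4) / (1 - m' ^ 4)) with (2 * / (1 - m' ^ 4) - 1) by (field; lra).
assert (/ (1 - m ^ 4) < / (1 - m' ^ 4)); [|lra].
apply Rinv_lt_contravar; [apply Rmult_lt_0_compat|]; lra.
Qed.

Lemma axis_order (m : R) : 1 / 7 <= m -> m <= 2 / 5 -> 2 / 3 < axis_small m < axis_big m /\
  axis_big m < 3.
Proof.
intros H0 H1; assert (D := axis_den_pos m ltac:(lra)); split; [split|].
- assert (Q4 : 0 < m ^ 4) by (apply pow_lt; lra).
  assert (Q : m ^ 4 < 1) by (assert (m ^ 2 < 1) by (simpl; nra); nra).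
  rewrite axis_small_value by lra.
  replace ((1 + m ^ 4) / (1 - m ^ 4)) with (1 + 2 * m ^ 4 * / (1 - m ^ 4)) by (field; lra).
  assert (0 < 2 * m ^ 4 * / (1 - m ^ 4)); [|lra].
  apply Rmult_lt_0_compat; [lra|apply Rinv_0_lt_compat; lra].
- unfold axis_small, axis_big; apply Rmult_lt_compat_r; [now apply Rinv_0_lt_compat|].
  (* The difference of the two numerators. Its first factor vanishes at [sqrt 2 - 1], where the
     points meet. *)
  assert (0 < (1 - 2 * m - m ^ 2) * ((1 - m) ^ 2 + m ^ 2 + 2 * m ^ 3 + m ^ 4)); [|lra].
  apply Rmult_lt_0_compat.
  + assert (m * m <= 2 / 5 * (2 / 5)) by (apply Rmult_le_compat; lra); simpl; lra.
  + assert (0 < m ^ 2) by (apply pow_lt; lra); assert (0 < m ^ 3) by (apply pow_lt; lra).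
    assert (0 < m ^ 4) by (apply pow_lt; lra); assert (X := pow2_ge_0 (1 - m)); lra.
- unfold axis_big; apply (Rmult_lt_reg_r (axis_den m)); [exact D|].
  replace ((1 + 6 * m ^ 2 + m ^ 4) * (1 - m ^ 2) / axis_den m * axis_den m) with
    ((1 + 6 * m ^ 2 + m ^ 4) * (1 - m ^ 2)) by (field; lra).
  unfold axis_den.
  assert (Q : 0 < m ^ 2 <= 2 / 5 * (2 / 5)) by (simpl; nra).
  assert (0 < (18 * m * (1 + m ^ 2) - (1 + 6 * m ^ 2 + m ^ 4)) * (1 - m ^ 2)); [|lra].
  apply Rmult_lt_0_compat; [|lra].
  replace (m ^ 4) with (m ^ 2 * m ^ 2) by ring; nra.
Qed.

Lemma example_S3_S3 : exists_example S3 S3.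
Proof.
(* Ends between [2 / 3] and [3] give [x] between [- 8 / 15] and [2 / 5], where the weight is
   positive and the line has positive height, though barely so at the left end. *)
set (Fm := line_pullback 1 (2 / 5) (- (4 / 5)) (-1) (1096 / 100) (585 / 100)).
exists axis_field, Fm.
split.
{ left; rewrite S3_Se; split; apply line_pullback_in_class; lra. }
set (gap := fun m => line_gap 1 (2 / 5) (- (4 / 5)) (1096 / 100) (585 / 100)
  (axis_small m) (axis_big m)).
assert (PG : rational_over axis_den gap).
{ apply line_gap_rational; [unfold axis_den; polynomial_tac| |]; apply rational_quotient;
  polynomial_tac. }
assert (HD : forall m, 1 / 7 <= m <= 2 / 5 -> 0 < axis_den m)
  by (intros m Hm; apply axis_den_pos; lra).
assert (G0 : gap (1 / 7) * gap (1 / 5) < 0)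
  by (unfold gap, line_gap, axis_big, axis_small, axis_den, numer, weight; lra).
assert (G1 : gap (1 / 5) * gap (3 / 10) < 0)
  by (unfold gap, line_gap, axis_big, axis_small, axis_den, numer, weight; lra).
assert (G2 : gap (3 / 10) * gap (2 / 5) < 0)
  by (unfold gap, line_gap, axis_big, axis_small, axis_den, numer, weight; lra).
assert (OW : forall t, 2 / 3 < t -> 0 < outer_weight t).
{ intros t Ht; assert (2 / 3 * (2 / 3) <= t * t) by (apply Rmult_le_compat; lra).
  unfold outer_weight; simpl; lra. }
assert (Hlow : forall m, 1 / 7 < m < 2 / 5 -> gap m = 0 ->
  arc Fm left_half (0, axis_big m) (0, axis_small m) /\
  0 < fst (Fm (0, axis_small m)) /\ fst (Fm (0, axis_big m)) < 0).
{ intros m Hm Z; destruct (axis_order m ltac:(lra) ltac:(lra)) as [[O1 O2] O3].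
  assert (Hin : forall x, (x - (2 / 5 * axis_small m + - (4 / 5))) *
     (2 / 5 * axis_big m + - (4 / 5) - x) >= 0 -> - (8 / 15) <= x <= 2 / 5).
  { intros x Hx; split.
    - destruct (Rle_lt_dec (- (8 / 15)) x) as [L|L]; [exact L|exfalso].
      assert (0 < (2 / 5 * axis_small m + - (4 / 5) - x) * (2 / 5 * axis_big m + - (4 / 5) - x))
        by (apply Rmult_lt_0_compat; lra); lra.
    - destruct (Rle_lt_dec x (2 / 5)) as [L|L]; [exact L|exfalso].
      assert (0 < (x - (2 / 5 * axis_small m + - (4 / 5))) * (x - (2 / 5 * axis_big m + - (4 / 5))))
        by (apply Rmult_lt_0_compat; lra); lra. }
  apply (lower_side 1 (2 / 5) (- (4 / 5)) (1096 / 100) (585 / 100) 1); auto; try lra.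
  - intros x Hx; apply Hin in Hx; unfold weight.
    assert (0 <= (x + 8 / 15) * (8 / 15 - x)) by (apply Rmult_le_pos; lra); simpl; lra.
  - intros x Hx; apply Hin in Hx; lra.
  - intros u v _ _ Huv.
    assert (E : forall x, slope_num 1 (585 / 100) (1096 / 100) x =
      16029 / 125 + 4291241 / 5000 * x + 48087 / 25 * x ^ 2 + 898412 / 625 * x ^ 3)
      by (intros x; unfold slope_num, numer, weight; field).
    rewrite !E; intros Hk.
    assert (0 < (v - u) * (4291241 / 5000 + 48087 / 25 * (u + v)
      + 898412 / 625 * (u ^ 2 + u * v + v ^ 2))); [|lra].
    apply Rmult_lt_0_compat; [lra|].
    (* In terms of [u + v] and [u - v] the quadratic form is diagonal; the first square is centred
       at the minimum in [u + v]. *)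
    assert (A := pow2_ge_0 (u + v + 2404350 / 2695236)); assert (B := pow2_ge_0 (u - v)); lra. }
apply (three_limit_cycles _ _ (2 / 3) 3 (fun m => 0 < m < 1)
  axis_small axis_big gap (1 / 7) (1 / 5) (3 / 10) (2 / 5)); try lra.
- apply line_pullback_lipschitz.
- apply line_pullback_lipschitz.
- destruct (rational_roots_finite axis_den gap (1 / 7) PG) as [L HL].
  + assert (X := HD (1 / 7) ltac:(lra)); lra.
  + intros E; rewrite E in G0; lra.
  + exists L; intros m Hm; apply HL; assert (X := axis_den_pos m Hm); lra.
- intros y1 y2 B1 B2 Hne A1 A2.
  destruct (axis_parameter y1 y2) as [m [Hm [E1 E2]]]; auto; try lra.
  + apply OW; lra.
  + apply OW; lra.
  + apply (axis_relation right_half); auto; lra.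
  + exists m; split; [exact Hm|split; [|now left]].
    apply line_pullback_relation in A2; [|now left|lra].
    rewrite E1, E2 in A2; unfold gap, line_gap; lra.
- intros m Hm; destruct (axis_order m ltac:(lra) ltac:(lra)) as [[O1 O2] O3]; lra.
- intros m Hm Z; destruct (axis_order m ltac:(lra) ltac:(lra)) as [[O1 O2] O3].
  split; [|now apply Hlow].
  apply axis_arc; auto; [lra|apply axis_pair_param; lra].
- intros m Hm Z; destruct (axis_order m ltac:(lra) ltac:(lra)) as [[O1 O2] O3].
  destruct (axis_arc (axis_small m) (axis_big m)) as [_ [X1 X2]]; auto; [lra| |].
  { apply axis_pair_param; lra. }
  destruct (Hlow m Hm Z) as [_ [X3 X4]]; auto.
- intros m m' K1 K2 K3 E.
  assert (X := axis_small_increasing m m' ltac:(lra) ltac:(lra) ltac:(lra)); lra.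
- apply (rational_zero_between axis_den); auto; try lra; intros m Hm; apply HD; lra.
- apply (rational_zero_between axis_den); auto; try lra; intros m Hm; apply HD; lra.
- apply (rational_zero_between axis_den); auto; try lra; intros m Hm; apply HD; lra.
Qed.

(** * S1 together with S2 *)

Lemma S1_lipschitz : lipschitz_field S1.
Proof.
apply (lipschitz_field_ext S1
  (fun p => - snd p + fst p ^ 3 - fst p * snd p ^ 2)
  (fun p => fst p + fst p ^ 2 * snd p - snd p ^ 3)); [reflexivity| |]; lipschitz.
Qed.

Lemma S2_lipschitz : lipschitz_field S2.
Proof.
apply (lipschitz_field_ext S2
  (fun p => - snd p + fst p ^ 3 - 3 * fst p * snd p ^ 2)
  (fun p => fst p + 3 * fst p ^ 2 * snd p - snd p ^ 3)); [reflexivity| |]; lipschitz.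
Qed.

Lemma S1_first_integral (k : R -> R * R) (T : R) : 0 <= T -> solution_on S1 k T ->
  (1 + 2 * fst (k 0) * snd (k 0)) * (fst (k T) ^ 2 + snd (k T) ^ 2) =
  (1 + 2 * fst (k T) * snd (k T)) * (fst (k 0) ^ 2 + snd (k 0) ^ 2).
Proof.
intros HT Hk.
assert (D := solution_coordinates S1 (fun x y => - y + x ^ 3 - x * y ^ 2)
  (fun x y => x + x ^ 2 * y - y ^ 3) k T (fun x y => eq_refl) Hk); cbv beta in D.
set (X := fun t => fst (k t)) in D; set (Y := fun t => snd (k t)) in D.
change (forall t, 0 <= t <= T -> is_derive X t (- Y t + X t ^ 3 - X t * Y t ^ 2) /\
  is_derive Y t (X t + X t ^ 2 * Y t - Y t ^ 3)) in D.
change ((1 + 2 * X 0 * Y 0) * (X T ^ 2 + Y T ^ 2) = (1 + 2 * X T * Y T) * (X 0 ^ 2 + Y 0 ^ 2)).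
clearbody X Y.
assert (D' : forall t, 0 <= t <= T ->
  Derive (fun t => X t) t = - Y t + X t ^ 3 - X t * Y t ^ 2 /\
  Derive (fun t => Y t) t = X t + X t ^ 2 * Y t - Y t ^ 3)
  by (intros t Ht; destruct (D t Ht); split; now apply is_derive_unique).
apply (cofactor_proportional (fun t => 1 + 2 * X t * Y t) (fun t => X t ^ 2 + Y t ^ 2)
  (fun t => 2 * (X t ^ 2 - Y t ^ 2)) T HT);
  intros t Ht; destruct (D t Ht) as [D1 D2], (D' t Ht) as [E1 E2].
- auto_derive; [repeat split; eexists; eassumption|rewrite E1, E2; ring].
- auto_derive; [repeat split; eexists; eassumption|rewrite E1, E2; ring].
- apply (is_derive_continuity_pt _ t (2 * (2 * X t * (- Y t + X t ^ 3 - X t * Y t ^ 2)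
    - 2 * Y t * (X t + X t ^ 2 * Y t - Y t ^ 3)))).
  auto_derive; [repeat split; eexists; eassumption|rewrite E1, E2; ring].
Qed.

Lemma S2_first_integral (k : R -> R * R) (T : R) : 0 <= T -> solution_on S2 k T ->
  (1 + 4 * fst (k 0) * snd (k 0)) * (fst (k T) ^ 2 + snd (k T) ^ 2) ^ 2 =
  (1 + 4 * fst (k T) * snd (k T)) * (fst (k 0) ^ 2 + snd (k 0) ^ 2) ^ 2.
Proof.
intros HT Hk.
assert (D := solution_coordinates S2 (fun x y => - y + x ^ 3 - 3 * x * y ^ 2)
  (fun x y => x + 3 * x ^ 2 * y - y ^ 3) k T (fun x y => eq_refl) Hk); cbv beta in D.
set (X := fun t => fst (k t)) in D; set (Y := fun t => snd (k t)) in D.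
change (forall t, 0 <= t <= T -> is_derive X t (- Y t + X t ^ 3 - 3 * X t * Y t ^ 2) /\
  is_derive Y t (X t + 3 * X t ^ 2 * Y t - Y t ^ 3)) in D.
change ((1 + 4 * X 0 * Y 0) * (X T ^ 2 + Y T ^ 2) ^ 2
  = (1 + 4 * X T * Y T) * (X 0 ^ 2 + Y 0 ^ 2) ^ 2).
clearbody X Y.
assert (D' : forall t, 0 <= t <= T ->
  Derive (fun t => X t) t = - Y t + X t ^ 3 - 3 * X t * Y t ^ 2 /\
  Derive (fun t => Y t) t = X t + 3 * X t ^ 2 * Y t - Y t ^ 3)
  by (intros t Ht; destruct (D t Ht); split; now apply is_derive_unique).
apply (cofactor_proportional (fun t => 1 + 4 * X t * Y t) (fun t => (X t ^ 2 + Y t ^ 2) ^ 2)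
  (fun t => 4 * (X t ^ 2 - Y t ^ 2)) T HT);
  intros t Ht; destruct (D t Ht) as [D1 D2], (D' t Ht) as [E1 E2].
- auto_derive; [repeat split; eexists; eassumption|rewrite E1, E2; ring].
- auto_derive; [repeat split; eexists; eassumption|rewrite E1, E2; ring].
- apply (is_derive_continuity_pt _ t (4 * (2 * X t * (- Y t + X t ^ 3 - 3 * X t * Y t ^ 2)
    - 2 * Y t * (X t + 3 * X t ^ 2 * Y t - Y t ^ 3)))).
  auto_derive; [repeat split; eexists; eassumption|rewrite E1, E2; ring].
Qed.

Lemma is_derive_inv_sqrt (f : R -> R) (x df : R) : is_derive f x df -> 0 < f x ->
  is_derive (fun x => / sqrt (f x)) x (- (df / (2 * f x)) * / sqrt (f x)).
Proof.
intros Hf Pf; assert (Q := sqrt_lt_R0 _ Pf).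
evar_last.
- apply (is_derive_inv (fun x => sqrt (f x))); [|lra].
  apply (is_derive_sqrt f); [exact Hf|exact Pf].
- assert (E : sqrt (f x) * sqrt (f x) = f x) by (apply sqrt_sqrt; lra).
  replace (2 * f x) with (2 * (sqrt (f x) * sqrt (f x))) by (rewrite E; ring).
  set (r := sqrt (f x)) in *; simpl; field; lra.
Qed.

Lemma inv_sqrt_square (r : R) : 0 < r -> / sqrt r * / sqrt r = / r.
Proof. intros P; rewrite <- Rinv_mult, sqrt_sqrt; [reflexivity|lra]. Qed.

Lemma inv_sqrt_gt_1 (r : R) : 0 < r < 1 -> 1 < / sqrt r.
Proof.
intros [P L]; assert (Q := sqrt_lt_R0 _ P).
assert (sqrt r < 1) by (rewrite <- sqrt_1; apply sqrt_lt_1; lra).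
rewrite <- Rinv_1; apply Rinv_lt_contravar; lra.
Qed.

(* On the line [x = 1/2], [y = t - 1], the first integral of S1 is [t / (t^2 - 2 t + 5/4)]. *)
Definition conic_field : vfield := pullback S1 1 0 (1 / 2) 0 1 (-1).

Lemma conic_speed (t : R) : fst (conic_field (0, t)) = (5 / 4 - t ^ 2) / 2.
Proof. unfold conic_field, pullback; simpl; field. Qed.

Lemma conic_relation (side : R * R -> Prop) (t1 t2 : R) : t1 <> t2 ->
  arc conic_field side (0, t1) (0, t2) -> t1 * t2 = 5 / 4.
Proof.
intros Hne [T [k [HT [Hk [E0 [ET _]]]]]].
assert (Hdet : 0 * 0 - 1 * 1 <> 0) by lra.
assert (H := S1_first_integral _ T (Rlt_le _ _ HT)
  (solution_pushforward S1 1 0 (1 / 2) 0 1 (-1) k T Hdet Hk)).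
cbn [fst snd] in H; rewrite E0, ET in H; cbn [fst snd] in H.
apply (Rmult_eq_reg_l (t1 - t2)); [|lra]; ring_simplify in H; lra.
Qed.

(* The orbit is parametrised by the point where the ray through it meets the line. *)
Lemma conic_arc (t1 t2 : R) : 0 < t1 -> t1 < t2 -> t1 * t2 = 5 / 4 -> t1 + t2 < 3 ->
  arc conic_field right_half (0, t1) (0, t2).
Proof.
intros H1 H12 Hp Hs.
assert (S2 : 2 < t1 + t2).
{ assert (A := pow2_ge_0 (t1 - t2)).
  destruct (Rlt_le_dec 2 (t1 + t2)) as [L|L]; [exact L|exfalso].
  assert ((t1 + t2) * (t1 + t2) <= 2 * 2) by (apply Rmult_le_compat; lra). lra. }
(* The common value of the first integral at the two ends, simplified by [t1 * t2 = 5 / 4]. Dilating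
   the point of the line at parameter [s] by [w] reaches this level exactly when [/ w ^ 2 = q s]. *)
set (C := / (t1 + t2 - 2)).
assert (HC : 1 < C) by (unfold C; rewrite <- Rinv_1; apply Rinv_lt_contravar; lra).
assert (EC : C * (t1 + t2 - 2) = 1) by (unfold C; field; lra).
set (q := fun s => C * (1 / 4 + (s - 1) ^ 2) - (s - 1)).
assert (Eq : forall s, q s = 1 + C * ((s - t1) * (s - t2))).
{ intros s; replace ((s - t1) * (s - t2)) with (s ^ 2 - (t1 + t2) * s + t1 * t2) by ring.
  rewrite Hp; transitivity (1 + C * (s ^ 2 - (t1 + t2) * s + 5 / 4) +
    s * (C * (t1 + t2 - 2) - 1)); [unfold q; field|rewrite EC; ring]. }
assert (Pq : forall s, 0 < q s).
(* For [C = 1] the polynomial [q] is the square of [s - 3 / 2]; the bound [t1 + t2 < 3] gives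
   [C > 1], hence strict positivity. *)
{ intros s; unfold q; assert (A := pow2_ge_0 (s - 1 - 1 / 2)); assert (B := pow2_ge_0 (s - 1)).
  assert (0 < (C - 1) * (1 / 4 + (s - 1) ^ 2)) by (apply Rmult_lt_0_compat; lra). lra. }
assert (Dq : forall s, is_derive q s (2 * C * (s - 1) - 1)).
{ intros s; unfold q; auto_derive; [trivial|ring]. }
set (w := fun s => / sqrt (q s)).
set (dw := fun s => - ((2 * C * (s - 1) - 1) / (2 * q s)) * w s).
assert (Dw : forall s, is_derive w s (dw s))
  by (intros s; apply is_derive_inv_sqrt; [apply Dq|apply Pq]).
assert (W1 : forall s, q s = 1 -> w s = 1) by (intros s E; unfold w; rewrite E, sqrt_1; field).
assert (Q1 : w t1 = 1) by (apply W1; rewrite Eq; ring).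
assert (Q2 : w t2 = 1) by (apply W1; rewrite Eq; ring).
apply (arc_pullback S1 1 0 (1 / 2) 0 1 (-1) (fun p => 1 / 2 < fst p)); [lra| |].
{ intros z; simpl; intros Hz; unfold right_half; lra. }
cbn [fst snd].
replace (1 * 0 + 0 * t1 + 1 / 2) with (1 / 2 * w t1) by (rewrite Q1; ring).
replace (1 * 0 + 0 * t2 + 1 / 2) with (1 / 2 * w t2) by (rewrite Q2; ring).
replace (0 * 0 + 1 * t1 + -1) with ((t1 - 1) * w t1) by (rewrite Q1; ring).
replace (0 * 0 + 1 * t2 + -1) with ((t2 - 1) * w t2) by (rewrite Q2; ring).
(* The field [S1] has angular speed 1 about the origin. The ray has slope [2 * (s - 1)], so [s]
   moves at speed [2 * (1 / 4 + (s - 1) ^ 2)]. *)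
apply (arc_along S1 _ (fun s => 1 / 2 * w s) (fun s => (s - 1) * w s)
  (fun s => 1 / 2 * dw s) (fun s => w s + (s - 1) * dw s)
  (fun s => 2 * (1 / 4 + (s - 1) ^ 2)) (t1 - 1) t1 t2 (t2 + 1)); try lra.
- intros s _; split; [|assert (B := pow2_ge_0 (s - 1)); lra].
  apply (is_derive_continuity_pt _ s (4 * (s - 1))); auto_derive; [trivial|ring].
- intros s _; split; [now apply is_derive_scal|].
  evar_last.
  + apply (is_derive_mult (fun s => s - 1) w s 1 (dw s));
      [auto_derive; [trivial|ring]|apply Dw|intros; apply Rmult_comm].
  + unfold plus, mult; simpl; unfold plus, mult; simpl; ring.
- intros s _; assert (P := Pq s); assert (E := inv_sqrt_square (q s) P); fold (w s) in E.
  unfold S1; f_equal.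
  + transitivity (w s * (- (s - 1) + (w s * w s) * (1 / 8 - (s - 1) ^ 2 / 2))); [field|].
    rewrite E; unfold dw; unfold q in *; field; lra.
  + transitivity (w s * (1 / 2 + (w s * w s) * ((s - 1) / 4 - (s - 1) ^ 3))); [field|].
    rewrite E; unfold dw; unfold q in *; field; lra.
- intros s Hs'; simpl; assert (1 < w s); [|lra].
  apply inv_sqrt_gt_1; split; [apply Pq|rewrite Eq].
  assert (0 < C * ((s - t1) * (t2 - s))) by (repeat apply Rmult_lt_0_compat; lra). lra.
Qed.

(* [ray_n / ray_d^2] is the first integral of S2 on the line [(b s + c, be s + ga)], and
   [ray_slope / ray_d^3] its derivative. *)
Definition ray_n (b c be ga s : R) : R := 1 + 4 * ((b * s + c) * (be * s + ga)).
Definition ray_d (b c be ga s : R) : R := (b * s + c) ^ 2 + (be * s + ga) ^ 2.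
Definition ray_slope (b c be ga s : R) : R :=
  4 * (b * (be * s + ga) + (b * s + c) * be) * ray_d b c be ga s
  - 4 * ray_n b c be ga s * ((b * s + c) * b + (be * s + ga) * be).

(* Dilating the point of the line at parameter [s] by [rho^(-1/2)] gives a point of the orbit as soon
   as [rho^2 + 4 x y rho = kap d^2], hence the square roots below. *)
Lemma ray_arc (b c be ga t1 t2 : R) : c * be - ga * b < 0 -> t1 < t2 ->
  (forall s, t1 <= s <= t2 -> 0 < 1 + 2 * ((b * s + c) * (be * s + ga))) ->
  0 < ray_n b c be ga t1 ->
  ray_n b c be ga t1 * ray_d b c be ga t2 ^ 2 = ray_n b c be ga t2 * ray_d b c be ga t1 ^ 2 ->
  (forall u v, t1 <= u -> u < v -> v <= t2 ->
     ray_slope b c be ga u <= 0 -> ray_slope b c be ga v < 0) ->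
  ray_slope b c be ga t2 < 0 < ray_slope b c be ga t1 /\
  arc S2 (fun p => be * fst p - b * snd p < c * be - ga * b)
    (b * t2 + c, be * t2 + ga) (b * t1 + c, be * t1 + ga).
Proof.
intros Hdet H12 Hturn HN1 Hrel HK.
set (x := fun s => b * s + c); set (y := fun s => be * s + ga).
set (N := ray_n b c be ga) in *; set (d := ray_d b c be ga) in *.
set (K := ray_slope b c be ga) in *; set (De := c * be - ga * b) in *.
assert (EDe : forall s, De = x s * be - y s * b) by (intros s; unfold De, x, y; ring).
assert (Pd : forall s, 0 < d s).
{ intros s; unfold d, ray_d; fold (x s) (y s).
  assert (A := pow2_ge_0 (x s)); assert (B := pow2_ge_0 (y s)).
  destruct (Req_dec (x s) 0) as [Ex|Ex].
  - destruct (Req_dec (y s) 0) as [Ey|Ey].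
    + assert (Z := EDe s); rewrite Ex, Ey in Z; lra.
    + assert (0 < y s ^ 2) by (rewrite <- Rsqr_pow2; now apply Rsqr_pos_lt); lra.
  - assert (0 < x s ^ 2) by (rewrite <- Rsqr_pow2; now apply Rsqr_pos_lt); lra. }
(* The integral rises and then falls between the ends, so its opposite fits the single crossing
   lemmas. *)
set (h := fun s => - (N s / d s ^ 2)); set (dh := fun s => - (K s / d s ^ 3)).
assert (Hd : forall s, t1 <= s <= t2 -> is_derive h s (dh s)).
{ intros s _; assert (P := Pd s); unfold h, dh, N, K, ray_slope, d, ray_n, ray_d in *.
  auto_derive; [|field]; repeat split; auto; try lra.
  apply (Rmult_integral_contrapositive_currified); simpl in P |- *; lra. }
assert (Heq : h t1 = h t2).
{ unfold h; f_equal; assert (P1 := Pd t1); assert (P2 := Pd t2).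
  apply (Rmult_eq_reg_r (d t1 ^ 2 * d t2 ^ 2)).
  - transitivity (N t1 * d t2 ^ 2); [field; lra|]; rewrite Hrel; field; lra.
  - apply Rmult_integral_contrapositive_currified; apply pow_nonzero; lra. }
assert (P3 : forall s, 0 < / d s ^ 3) by (intros s; apply Rinv_0_lt_compat, pow_lt, Pd).
assert (Hcross : forall u v, t1 <= u -> u < v -> v <= t2 -> 0 <= dh u -> 0 < dh v).
{ intros u v Hu Huv Hv Pu; unfold dh, Rdiv in *.
  assert (A := P3 u); assert (B := P3 v).
  assert (KU : K u <= 0) by (apply (Rmult_le_reg_r (/ d u ^ 3)); lra).
  assert (KV := HK u v Hu Huv Hv KU).
  assert (0 < (- K v) * / d v ^ 3) by (apply Rmult_lt_0_compat; lra); lra. }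
split.
{ destruct (single_crossing_ends h dh t1 t2 H12 Hd Heq Hcross) as [A B].
  assert (Q1 := P3 t1); assert (Q2 := P3 t2); unfold dh, Rdiv in A, B; split.
  - apply (Rmult_lt_reg_r (/ d t2 ^ 3)); lra.
  - apply (Rmult_lt_reg_r (/ d t1 ^ 3)); lra. }
set (kap := N t1 / d t1 ^ 2).
assert (Pk : 0 < kap) by (apply Rdiv_lt_0_compat; [exact HN1|apply pow_lt, Pd]).
set (E := fun s => 4 * (x s * y s) ^ 2 + kap * d s ^ 2).
assert (PE : forall s, 0 < E s).
{ intros s; unfold E; assert (A := pow2_ge_0 (x s * y s)).
  assert (0 < kap * d s ^ 2) by (apply Rmult_lt_0_compat; [exact Pk|apply pow_lt, Pd]); lra. }
set (rt := fun s => sqrt (E s)).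
assert (Prt : forall s, 0 < rt s) by (intros s; apply sqrt_lt_R0, PE).
assert (Ert : forall s, rt s * rt s = E s) by (intros s; apply sqrt_sqrt, Rlt_le, PE).
set (rho := fun s => rt s - 2 * (x s * y s)).
assert (Prho : forall s, 0 < rho s).
{ intros s; unfold rho; destruct (Rle_lt_dec (x s * y s) 0) as [L|L].
  - assert (P := Prt s); lra.
  - assert (2 * (x s * y s) < rt s); [|lra].
    apply Rsqr_incrst_0; [|lra|apply Rlt_le, Prt].
    unfold Rsqr; rewrite Ert; unfold E.
    assert (0 < kap * d s ^ 2) by (apply Rmult_lt_0_compat; [exact Pk|apply pow_lt, Pd]); lra. }
set (dm := fun s => b * y s + x s * be); set (dd := fun s => 2 * (x s * b + y s * be)).
set (dE := fun s => 8 * (x s * y s) * dm s + 2 * kap * d s * dd s).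
assert (DE : forall s, is_derive E s (dE s)).
{ intros s; unfold E, dE, dm, dd, d, ray_d, x, y; auto_derive; [trivial|ring]. }
set (drt := fun s => dE s / (2 * rt s)).
assert (Drt : forall s, is_derive rt s (drt s))
  by (intros s; apply (is_derive_sqrt E); [apply DE|apply PE]).
set (drho := fun s => drt s - 2 * dm s).
assert (Drho : forall s, is_derive rho s (drho s)).
{ intros s; unfold rho, drho.
  apply (is_derive_minus (V := R_NormedModule) rt (fun s => 2 * (x s * y s))); [apply Drt|].
  unfold x, y, dm; auto_derive; [trivial|unfold x, y; ring]. }
set (w := fun s => / sqrt (rho s)).
set (dw := fun s => - (drho s / (2 * rho s)) * w s).
assert (Dw : forall s, is_derive w s (dw s))
  by (intros s; apply is_derive_inv_sqrt; [apply Drho|apply Prho]).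
(* At the ends [E] is the square of [1 + 2 * (x s * y s)], the angular speed of [S2] there. Its
   positivity selects the correct square root. *)
assert (W1 : forall s, 0 < 1 + 2 * (x s * y s) -> kap * d s ^ 2 = N s -> w s = 1).
{ intros s Ht Ek; assert (Er : rt s = 1 + 2 * (x s * y s)).
  { apply Rsqr_inj; [apply Rlt_le, Prt|lra|]; unfold Rsqr; rewrite Ert; unfold E; rewrite Ek.
    unfold N, ray_n; fold (x s) (y s); ring. }
  unfold w, rho; rewrite Er; replace (1 + 2 * (x s * y s) - 2 * (x s * y s)) with 1 by ring.
  rewrite sqrt_1; field. }
assert (Q1 : w t1 = 1).
{ apply W1; [apply Hturn; lra|]; unfold kap; field; assert (P := Pd t1); lra. }
assert (Q2 : w t2 = 1).
{ apply W1; [apply Hturn; lra|]; replace kap with (N t2 / d t2 ^ 2).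
  - field; assert (P := Pd t2); lra.
  - unfold h in Heq; unfold kap; lra. }
(* The angular speed of [S2] at the dilated point is [rt / rho], and the ray turns by [De / d] per
   unit of [s]; [cc] is the quotient. It is negative because [De] is, so the arc is run
   backwards. *)
set (cc := fun s => rt s * d s / (rho s * De)).
replace (b * t2 + c) with (x t2 * w t2) by (rewrite Q2; unfold x; ring).
replace (be * t2 + ga) with (y t2 * w t2) by (rewrite Q2; unfold y; ring).
replace (b * t1 + c) with (x t1 * w t1) by (rewrite Q1; unfold x; ring).
replace (be * t1 + ga) with (y t1 * w t1) by (rewrite Q1; unfold y; ring).
apply (arc_along_reverse S2 _ (fun s => x s * w s) (fun s => y s * w s)
  (fun s => b * w s + x s * dw s) (fun s => be * w s + y s * dw s) cc
  (t1 - 1) t1 t2 (t2 + 1)); try lra.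
- intros s _; split.
  + unfold cc, Rdiv; apply continuity_pt_mult; [apply continuity_pt_mult|].
    * exact (is_derive_continuity_pt _ _ _ (Drt s)).
    * apply (is_derive_continuity_pt _ s (dd s)); unfold d, ray_d, dd, x, y.
      auto_derive; [trivial|ring].
    * apply (continuity_pt_inv (fun s => rho s * De)).
      -- apply continuity_pt_mult; [exact (is_derive_continuity_pt _ _ _ (Drho s))|].
         apply continuity_pt_const; intros u v; reflexivity.
      -- apply Rmult_integral_contrapositive_currified; assert (P := Prho s); lra.
  + unfold cc; assert (0 < rt s * d s / (rho s * - De)).
    { apply Rdiv_lt_0_compat; apply Rmult_lt_0_compat; auto; lra. }
    assert (P := Prho s).
    replace (rt s * d s / (rho s * De)) with (- (rt s * d s / (rho s * - De))) by (field; lra).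
    lra.
- intros s _; split.
  + apply (is_derive_mult x w s b (dw s)); [|apply Dw|intros; apply Rmult_comm].
    unfold x; auto_derive; [trivial|ring].
  + apply (is_derive_mult y w s be (dw s)); [|apply Dw|intros; apply Rmult_comm].
    unfold y; auto_derive; [trivial|ring].
- intros s _; assert (P := Prho s); assert (Ew := inv_sqrt_square (rho s) P); fold (w s) in Ew.
  assert (Pds := Pd s); assert (Prs := Prt s).
  assert (Ek : kap = (rt s * rt s - 4 * (x s * y s) ^ 2) / d s ^ 2).
  { rewrite Ert; unfold E; field; lra. }
  assert (Ed : d s = x s ^ 2 + y s ^ 2) by reflexivity.
  assert (Nz : x s * be - y s * b <> 0) by (rewrite <- EDe; lra).
  unfold S2; f_equal.
  + transitivity (w s * (- y s + (w s * w s) * (x s ^ 3 - 3 * x s * y s ^ 2))); [ring|].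
    rewrite Ew; unfold cc, dw, drho, drt, dE; rewrite Ek, (EDe s); unfold dm, dd, rho in *.
    rewrite Ed in *; field; lra.
  + transitivity (w s * (x s + (w s * w s) * (3 * x s ^ 2 * y s - y s ^ 3))); [ring|].
    rewrite Ew; unfold cc, dw, drho, drt, dE; rewrite Ek, (EDe s); unfold dm, dd, rho in *.
    rewrite Ed in *; field; lra.
- intros s Hs; cbn [fst snd].
  replace (be * (x s * w s) - b * (y s * w s)) with (De * w s) by (rewrite (EDe s); ring).
  assert (Ht := Hturn s ltac:(lra)); fold (x s) (y s) in Ht.
  assert (1 < w s).
  { apply inv_sqrt_gt_1; split; [apply Prho|unfold rho].
    (* After squaring, this inequality is [kap * d s ^ 2 < N s]: inside the segment the first
       integral exceeds its end value. *)
    assert (rt s < 1 + 2 * (x s * y s)); [|lra].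
    apply Rsqr_incrst_0; [|apply Rlt_le, Prt|lra].
    unfold Rsqr; rewrite Ert; unfold E.
    assert (B := single_crossing_below h dh t1 t2 Hd Heq Hcross s Hs).
    unfold h in B; fold kap in B.
    assert (Q := pow_lt _ 2 (Pd s)).
    assert (L : kap * d s ^ 2 < N s / d s ^ 2 * d s ^ 2) by (apply Rmult_lt_compat_r; lra).
    replace (N s / d s ^ 2 * d s ^ 2) with (N s) in L by (field; assert (P := Pd s); lra).
    unfold N, ray_n in L; fold (x s) (y s) in L; lra. }
  assert (0 < (- De) * (w s - 1)) by (apply Rmult_lt_0_compat; lra); lra.
Qed.

Lemma ray_speed (b c be ga t : R) : b <> 0 ->
  fst (pullback S2 0 b c (-1) be ga (0, t)) = ray_slope b c be ga t / (4 * b).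
Proof.
intros Hb; unfold pullback, ray_slope, ray_n, ray_d; simpl; field; lra.
Qed.

Lemma ray_relation (b c be ga : R) (side : R * R -> Prop) (t1 t2 : R) : b <> 0 ->
  arc (pullback S2 0 b c (-1) be ga) side (0, t1) (0, t2) ->
  ray_n b c be ga t1 * ray_d b c be ga t2 ^ 2 = ray_n b c be ga t2 * ray_d b c be ga t1 ^ 2.
Proof.
intros Hb [T [k [HT [Hk [E0 [ET _]]]]]].
assert (Hdet : b * -1 - 0 * be <> 0) by lra.
assert (H := S2_first_integral _ T (Rlt_le _ _ HT)
  (solution_pushforward S2 0 b c (-1) be ga k T Hdet Hk)).
cbn [fst snd] in H; rewrite E0, ET in H; cbn [fst snd] in H.
unfold ray_n, ray_d; ring_simplify in H; ring_simplify; exact H.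
Qed.

(* The divided difference of [ray_n / ray_d^2] in terms of the sum [S] and product [P]. *)
Definition ray_divided (b c be ga S P : R) : R :=
  let n0 := 1 + 4 * c * ga in let n1 := 4 * (b * ga + c * be) in let n2 := 4 * b * be in
  let d0 := c ^ 2 + ga ^ 2 in let d1 := 2 * (b * c + be * ga) in let d2 := b ^ 2 + be ^ 2 in
  let D0 := d0 ^ 2 in let D1 := 2 * d0 * d1 in let D2 := d1 ^ 2 + 2 * d0 * d2 in
  let D3 := 2 * d1 * d2 in let D4 := d2 ^ 2 in
  n0 * (D1 + D2 * S + D3 * (S ^ 2 - P) + D4 * (S * (S ^ 2 - 2 * P)))
  + n1 * (D2 * P + D3 * (P * S) + D4 * (P * (S ^ 2 - P)) - D0)
  + n2 * (D3 * P ^ 2 + D4 * (P ^ 2 * S) - D0 * S - D1 * P).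

Lemma ray_divided_spec (b c be ga t1 t2 : R) :
  ray_n b c be ga t1 * ray_d b c be ga t2 ^ 2 - ray_n b c be ga t2 * ray_d b c be ga t1 ^ 2
  = (t2 - t1) * ray_divided b c be ga (t1 + t2) (t1 * t2).
Proof. unfold ray_n, ray_d, ray_divided; ring. Qed.

(** Pairs with product [5 / 4] are indexed by their sum. The points themselves are irrational in
    [S], but the divided difference is symmetric in them, so the condition of the other side is a
    polynomial in [S]. *)
Definition conic_small (S : R) : R := (S - sqrt (S ^ 2 - 5)) / 2.
Definition conic_big (S : R) : R := (S + sqrt (S ^ 2 - 5)) / 2.

Lemma conic_roots (S : R) : 9 / 4 < S -> 0 < conic_small S < conic_big S /\
  conic_small S + conic_big S = S /\ conic_small S * conic_big S = 5 / 4.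
Proof.
intros HS; assert (P : 0 < S ^ 2 - 5).
{ assert (9 / 4 * (9 / 4) <= S * S) by (apply Rmult_le_compat; lra); simpl; lra. }
assert (Q := sqrt_lt_R0 _ P).
assert (E : sqrt (S ^ 2 - 5) * sqrt (S ^ 2 - 5) = S ^ 2 - 5) by (apply sqrt_sqrt; lra).
unfold conic_small, conic_big; set (r := sqrt (S ^ 2 - 5)) in *.
assert (r < S) by (apply Rsqr_incrst_0; unfold Rsqr; simpl in *; lra).
repeat split; lra.
Qed.

Lemma example_S1_S2 : exists_example S1 S2.
Proof.
(* With these values [ray_divided] at product [5 / 4] alternates in sign at the sums [9 / 4],
   [47 / 20], [5 / 2], [13 / 5]. They lie between [sqrt 5], where the two points meet, and the bound
   3 of [conic_arc]. *)
set (b := 2467 / 10000); set (c := - (7983 / 10000));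
set (be := 2533 / 10000); set (ga := 74 / 10000).
set (Fm := pullback S2 0 b c (-1) be ga).
exists conic_field, Fm; split.
{ left; split; apply pullback_in_class; unfold b; lra. }
set (gap := fun S => ray_divided b c be ga S (5 / 4)).
assert (PG : polynomial gap) by (unfold gap, ray_divided; cbv zeta; polynomial_tac).
assert (RG : rational_over (fun _ => 1) gap) by now apply rational_polynomial.
assert (G0 : gap (9 / 4) * gap (47 / 20) < 0)
  by (unfold gap, ray_divided, b, c, be, ga; lra).
assert (G1 : gap (47 / 20) * gap (5 / 2) < 0)
  by (unfold gap, ray_divided, b, c, be, ga; lra).
assert (G2 : gap (5 / 2) * gap (13 / 5) < 0)
  by (unfold gap, ray_divided, b, c, be, ga; lra).
assert (Pturn : forall s, 0 < 1 + 2 * ((b * s + c) * (be * s + ga))).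
(* [8 / 5] is close to the minimiser of the product of the two coordinates. *)
{ intros s; unfold b, c, be, ga; assert (A := pow2_ge_0 (s - 8 / 5)); nra. }
assert (PN : forall s, 0 < ray_n b c be ga s).
{ intros s; unfold ray_n, b, c, be, ga; assert (A := pow2_ge_0 (s - 8 / 5)); nra. }
assert (HK : forall u v, u < v -> ray_slope b c be ga u <= 0 -> ray_slope b c be ga v < 0).
{ intros u v Huv Hu.
  assert (E : forall s, ray_slope b c be ga s = 627446917880343 / 2500000000000000
    - 150738053772943 / 312500000000000 * s + 375785109140727 / 1250000000000000 * s ^ 2
    - 39062498814079 / 625000000000000 * s ^ 3)
    by (intros s; unfold ray_slope, ray_n, ray_d, b, c, be, ga; field).
  rewrite E in *.
  assert (0 < (v - u) * (150738053772943 / 312500000000000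
    - 375785109140727 / 1250000000000000 * (u + v)
    + 39062498814079 / 625000000000000 * (u ^ 2 + u * v + v ^ 2))); [|lra].
  apply Rmult_lt_0_compat; [lra|].
  (* The square is centred at the minimum in [u + v] of the diagonalised form, so [ray_slope] is
     strictly decreasing on the whole line. *)
  assert (A := pow2_ge_0 (u + v - 20038381 / 6248911)); assert (B := pow2_ge_0 (u - v)); lra. }
assert (Hlow : forall S, 9 / 4 < S < 13 / 5 -> gap S = 0 ->
  arc Fm left_half (0, conic_big S) (0, conic_small S) /\
  0 < fst (Fm (0, conic_small S)) /\ fst (Fm (0, conic_big S)) < 0).
{ intros S HS Z; destruct (conic_roots S ltac:(lra)) as [[O1 O2] [OS OP]].
  assert (Hb : b <> 0) by (unfold b; lra).
  unfold Fm; rewrite !ray_speed by exact Hb.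
  destruct (ray_arc b c be ga (conic_small S) (conic_big S)) as [[K1 K2] A]; auto.
  - unfold b, c, be, ga; lra.
  - apply Rminus_diag_uniq; rewrite ray_divided_spec, OS, OP; fold (gap S); rewrite Z; ring.
  - intros u v _ Huv _; now apply HK.
  - split; [|unfold b in *; lra].
    apply (arc_pullback S2 _ _ _ _ _ _ (fun p => be * fst p - b * snd p < c * be - ga * b)).
    + unfold b; lra.
    + intros z; simpl; intros Hz; unfold left_half.
      apply (Rmult_lt_reg_l b); [unfold b; lra|]; lra.
    + cbn [fst snd].
      replace (0 * 0 + b * conic_big S + c) with (b * conic_big S + c) by ring.
      replace (0 * 0 + b * conic_small S + c) with (b * conic_small S + c) by ring.
      replace (-1 * 0 + be * conic_big S + ga) with (be * conic_big S + ga) by ring.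
      replace (-1 * 0 + be * conic_small S + ga) with (be * conic_small S + ga) by ring.
      exact A. }
apply (three_limit_cycles _ _ 0 3 (fun _ => True)
  conic_small conic_big gap (9 / 4) (47 / 20) (5 / 2) (13 / 5)); try lra.
- apply pullback_lipschitz, S1_lipschitz.
- apply pullback_lipschitz, S2_lipschitz.
- destruct (polynomial_roots_finite gap (9 / 4) PG) as [L HL].
  + intros E; rewrite E in G0; lra.
  + exists L; intros m _; apply HL.
- intros y1 y2 B1 B2 Hne A1 A2.
  assert (Hp := conic_relation right_half y1 y2 Hne A1).
  apply ray_relation in A2; [|unfold b; lra].
  exists (y1 + y2); split; [exact I|split].
  + unfold gap; rewrite <- Hp; apply (Rmult_eq_reg_l (y2 - y1)); [|lra].
    rewrite <- ray_divided_spec, A2; ring.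
  + unfold conic_small, conic_big.
    replace ((y1 + y2) ^ 2 - 5) with ((y1 - y2) ^ 2) by lra.
    (* The sum does not remember the order of the ends, so both alternatives occur. *)
    destruct (Rle_lt_dec y1 y2) as [L|L]; [left|right].
    * replace ((y1 - y2) ^ 2) with ((y2 - y1) ^ 2) by ring; rewrite sqrt_pow2 by lra; split; field.
    * rewrite sqrt_pow2 by lra; split; field.
- intros S HS; destruct (conic_roots S ltac:(lra)) as [[O1 O2] [OS OP]]; lra.
- intros S HS Z; destruct (conic_roots S ltac:(lra)) as [[O1 O2] [OS OP]].
  split; [apply conic_arc; lra|now apply Hlow].
- intros S HS Z; destruct (conic_roots S ltac:(lra)) as [[O1 O2] [OS OP]].
  destruct (Hlow S HS Z) as [_ [X3 X4]]; rewrite !conic_speed.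
  assert (conic_small S * conic_small S < conic_small S * conic_big S)
    by (apply Rmult_lt_compat_l; lra).
  assert (conic_small S * conic_big S < conic_big S * conic_big S)
    by (apply Rmult_lt_compat_r; lra).
  split; [lra|split; [exact X3|split; [lra|exact X4]]].
- intros S S' K1 K2 K3 E.
  destruct (conic_roots S ltac:(lra)) as [[O1 O2] [OS OP]].
  destruct (conic_roots S' ltac:(lra)) as [[O1' O2'] [OS' OP']].
  rewrite E in OS, OP; assert (conic_big S = conic_big S'); [|lra].
  apply (Rmult_eq_reg_l (conic_small S')); lra.
- apply (rational_zero_between (fun _ => 1)); auto; intros; lra.
- apply (rational_zero_between (fun _ => 1)); auto; intros; lra.
- apply (rational_zero_between (fun _ => 1)); auto; intros; lra.
Qed.

Theorem theorem2 :
  exists_example S1 S2 /\ exists_example S3 S3 /\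
  exists_example S3 S4 /\ exists_example S4 S4.
Proof.
split; [exact example_S1_S2|split; [exact example_S3_S3|]].
split; [exact example_S3_S4|exact example_S4_S4].
Qed.
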